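(* Let $G=F_N$ be free of finite rank $N\ge 2$. There exists a constant $C>0$ such that for all sufficiently large $n$ we have \[ f_{prim}(4n+4)\ \ge\ \exp\left(\left(\frac{\log n}{C\log\log n}\right)^{1/4}\right). \] If we assume Babai's Conjecture on the diameter of Cayley graphs of permutation groups, then for all sufficiently large $n$ we have \[ f_{prim}(4n+4)\ \ge\ n^{\frac{1}{C\log\log n}}. \]
   Context: Fix a free basis $A$ of $F_N$ and let $|g|_A$ be the word length of $g$ with respect to $A$. For $1\ne g\in F_N$, $d_{prim}(g)$ is the minimum of $[F_N:H]$ over all finite-index subgroups $H\le F_N$ such that $g\in H$ and $g$ is primitive in $H$ (i.e. $g$ belongs to some free basis of $H$). The primitivity index function is $f_{prim}(n)=\max\{d_{prim}(g): g\in F_N,\ |g|_A\le n,\ g\neq 1,\ g \text{ is not a proper power in } F_N\}$. Babai's Conjecture (for permutation groups): there is a constant $\kappa>0$ such that for every $m\ge 2$, for $G_m$ equal to the alternating group $\mathrm{Alt}(m)$ or the symmetric group $\mathrm{Sym}(m)$, and for every generating set $S$ of $G_m$, the Cayley graph of $G_m$ with respect to $S\cup S^{-1}$ has diameter at most $m^{\kappa}$. *)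

(* Defs.v *)
From mathcomp Require Import all_boot all_order all_algebra all_fingroup all_solvable.
From mathcomp Require Import all_classical all_reals all_analysis.

Set Implicit Arguments.
Unset Strict Implicit.
Unset Printing Implicit Defensive.

Import Order.TTheory GRing.Theory Num.Theory.

Local Open Scope classical_set_scope.

(* Minimum and maximum of a set of naturals, 0 if there is none. The default is
   not reached below, except for f_prim at 0: every g <> 1 in a free group of
   finite rank is primitive in some subgroup of finite index (M. Hall), balls
   for the word length are finite, and the Cayley graphs are connected. *)
Definition min_nat (P : set nat) : nat :=
  xget 0%N [set k | P k /\ forall j, P j -> (k <= j)%N].

Definition max_nat (P : set nat) : nat :=
  xget 0%N [set k | P k /\ forall j, P j -> (j <= k)%N].

Section FreeGroups.
Variable F : groupType.
Implicit Types (g h x : F) (B H : set F).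

(* The letter (b, false) stands for b and (b, true) for b^-1. *)
Definition word := seq (F * bool).

Definition word_eval (w : word) : F :=
  (\big[*%g/1]_(l <- w) (if l.2 then l.1^-1 else l.1))%g.

Definition word_over B (w : word) : Prop := forall l, l \in w -> B l.1.

(* No two consecutive letters are mutually inverse. *)
Definition reduced (w : word) : bool :=
  sorted (fun l l' => (l.1 != l'.1) || (l.2 == l'.2)) w.

Definition is_subgroup H : Prop := group_closed (mem H).

Definition free_basis B H : Prop :=
  (forall w, word_over B w -> H (word_eval w)) /\
  (forall x, H x ->
     exists! w : word, [/\ word_over B w, reduced w & word_eval w = x]).

Definition primitive_in H g : Prop := exists2 B, free_basis B H & B g.

(* The index of H in F is the natural number k (in particular it is finite). *)
Definition has_index H (k : nat) : Prop :=
  ([set [set (x * h)%g | h in H] | x in [set: F]] #= `I_k)%card.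

Definition word_length A g : nat :=
  min_nat [set size w | w in [set w | word_over A w /\ word_eval w = g]].

Definition proper_power g : Prop := exists h k, (2 <= k)%N /\ g = (h ^+ k)%g.

Definition d_prim g : nat :=
  min_nat [set k | exists H,
    [/\ is_subgroup H, has_index H k, H g & primitive_in H g]].

Definition f_prim A (n : nat) : nat :=
  max_nat [set d_prim g | g in
    [set g | [/\ (word_length A g <= n)%N, g <> 1%g & ~ proper_power g]]].

End FreeGroups.

Section CayleyGraphs.

Definition graph_dist (T : finType) (e : rel T) (x y : T) : nat :=
  min_nat [set size p | p in [set p | path e x p /\ last x p = y]].

Definition graph_diam (T : finType) (V : {set T}) (e : rel T) : nat :=
  \max_(x in V) \max_(y in V) graph_dist e x y.

(* Edges x -- x * s with s in S or S^-1; since S is a subset of G in all uses,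
   the walks starting in G stay in G. *)
Definition cayley_edge (gT : finGroupType) (S : {set gT}) : rel gT :=
  fun x y => ((x^-1 * y)%g \in S :|: S^-1%g).

Definition cayley_diam (gT : finGroupType) (G S : {set gT}) : nat :=
  graph_diam G (cayley_edge S).

End CayleyGraphs.

Local Open Scope ring_scope.

Definition Babai_conjecture (R : realType) : Prop :=
  exists2 kappa : R, 0 < kappa &
    forall m : nat, (2 <= m)%N ->
    forall G : {set 'S_m},
      G = Alt 'I_m \/ G = Sym 'I_m ->
    forall S : {set 'S_m}, <<S>>%g = G ->
      (cayley_diam G S)%:R <= m%:R `^ kappa.

(* Main.v *)
Require Import Defs.
From mathcomp Require Import all_boot all_order all_algebra all_fingroup all_solvable.
From mathcomp Require Import all_classical all_reals all_analysis.
From mathcomp Require Import zify ring lra.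

(** Both lower bounds follow from a polynomial one: [n `^ (1 / 18)] is at most
    [f_prim A n] for large [n]. It is enough to find, for each large [m], a
    positive word [w] in the basis [A], of length at most [m ^ 18] and not a
    proper power, that is primitive in some subgroup of finite index but in none
    of index at most [m].

    Obstruction to primitivity. Let [H] have finite index and let [w] lie in [H].
    Read as a loop of the Schreier graph of [H], suppose that [w] takes every turn
    [ab] (in by the letter [a], out by the letter [b]) at every vertex. Then [w] is
    not primitive in [H] ([no_basis_with_all_turns]). Indeed, if [w] and
    [b <> w] belong to a basis of [H], the elements of [H] whose reduced word
    starts with [b] form a set that is stable under right multiplication by [w]
    and changes in finitely many places only under right multiplication by any
    element of [H]: in the Cayley tree of [F] it splits the ends in two nonempty parts,
    and each translate of the axis of [w] has both ends in the same part. But the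
    turns taken by these axes at a vertex join each incoming edge to each outgoing
    edge, and a complete bipartite graph with at least two vertices on each side
    remains connected when one vertex is removed, so that the parts can be
    propagated from the leaves of a ball to its centre: all the ends lie in the
    same part. This is the connectedness argument behind the cut vertex lemma of
    Whitehead.

    Universal words. A single word of polynomial length takes all the turns at all
    the vertices of all the transitive permutation representations of degree at
    most [m], from any starting point ([universal_word]). The lazy walk that
    appends a random positive letter or nothing is doubly stochastic and contracts
    the L2 norm of the functions of mean zero by a factor [1 - 1 / poly(m)], so
    after polynomially many steps it is almost uniform ([count_lazy_words]). Hence
    each open requirement (a representation, a starting vertex, a target) is met by
    a proportion [1 / 2k] of the trajectories, some trajectory meets that proportion
    of all the open requirements ([exists_good_segment]), and as there are only
    exponentially many of them, polynomially many segments meet them all.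

    Since [w] is positive, no cancellation occurs. A suffix makes the exponent sums
    of two letters consecutive, so [w] is not a proper power. Finally [d_prim w] is
    the minimum of a nonempty set because [w] is primitive in the subgroup of
    elements whose total degree is divisible by the length of [w]: the Schreier
    graph of this subgroup is a cycle of multiple edges, [w] runs once around it,
    and its prefixes form a spanning tree whose Schreier basis contains [w]
    ([degree_kernel_free_basis]). *)

Set Implicit Arguments.
Unset Strict Implicit.
Unset Printing Implicit Defensive.

Import Order.TTheory GRing.Theory Num.Theory.
Local Open Scope classical_set_scope.

(** * Words, free reduction and normal forms *)

Section Words.
Variable F : groupType.
Implicit Types (l : F * bool) (v w : word F) (B H : set F).

Definition flip l : F * bool := (l.1, ~~ l.2).

Lemma flipK : involutive flip.
Proof. by case=> x b; rewrite /flip /= negbK. Qed.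

Lemma flip_neq l : (l == flip l) = false.
Proof. by case: l => x [] /=; rewrite /flip xpair_eqE eqxx. Qed.

Definition letter_val l : F := (if l.2 then l.1^-1 else l.1)%g.

Lemma letter_val_flip l : (letter_val (flip l) = (letter_val l)^-1)%g.
Proof. by case: l => x [] //=; rewrite /letter_val /= invgK. Qed.

Lemma word_eval_nil : (word_eval [::] = 1 :> F)%g.
Proof. by rewrite /word_eval big_nil. Qed.

Lemma word_eval_cons l w : (word_eval (l :: w) = letter_val l * word_eval w)%g.
Proof. by rewrite /word_eval big_cons. Qed.

Lemma word_eval_cat v w : (word_eval (v ++ w) = word_eval v * word_eval w)%g.
Proof. by rewrite /word_eval big_cat. Qed.

Lemma word_eval_rcons w l : (word_eval (rcons w l) = word_eval w * letter_val l)%g.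
Proof. by rewrite -cats1 word_eval_cat word_eval_cons word_eval_nil mulg1. Qed.

Definition inv_word w : word F := rev (map flip w).

Lemma word_eval_inv w : (word_eval (inv_word w) = (word_eval w)^-1)%g.
Proof.
elim: w => [|l w IH]; first by rewrite /inv_word word_eval_nil invg1.
rewrite /inv_word /= rev_cons word_eval_rcons -/(inv_word w) IH.
by rewrite letter_val_flip word_eval_cons invgM.
Qed.

Lemma word_over_nil B : word_over B [::].
Proof. by []. Qed.

Lemma word_over_cat B v w : word_over B v -> word_over B w -> word_over B (v ++ w).
Proof. by move=> Bv Bw l; rewrite mem_cat => /orP[/Bv|/Bw]. Qed.

Lemma word_over_cons B l w : B l.1 -> word_over B w -> word_over B (l :: w).
Proof. by move=> Bl Bw x; rewrite inE => /predU1P[->|/Bw]. Qed.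

Lemma word_over_rcons B l w : B l.1 -> word_over B w -> word_over B (rcons w l).
Proof. by move=> Bl Bw x; rewrite mem_rcons inE => /predU1P[->|/Bw]. Qed.

Lemma word_over_rconsP B l w :
  word_over B (rcons w l) -> B l.1 /\ word_over B w.
Proof.
move=> Bw; split; first by apply: Bw; rewrite mem_rcons mem_head.
by move=> x xw; apply: Bw; rewrite mem_rcons inE xw orbT.
Qed.

Lemma word_over_inv B w : word_over B w -> word_over B (inv_word w).
Proof. by move=> Bw l; rewrite mem_rev => /mapP[x /Bw ? ->]. Qed.

Lemma reduced_letters l l' : (l.1 != l'.1) || (l.2 == l'.2) = (l' != flip l).
Proof.
case: l l' => x b [y c]; rewrite /flip /= xpair_eqE negb_and eq_sym.
by congr (_ || _); case: b c => [] [].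
Qed.

Lemma reduced_rcons2 w l l' :
  reduced (rcons (rcons w l) l') = reduced (rcons w l) && (l' != flip l).
Proof.
rewrite -reduced_letters /reduced; case: w => [|x w] /=; first by rewrite andbT.
by rewrite rcons_path last_rcons.
Qed.

Lemma reduced_rconsW w l : reduced (rcons w l) -> reduced w.
Proof.
by case/lastP: w => [//|w l']; rewrite reduced_rcons2 => /andP[].
Qed.

Lemma reduced_catl v w : reduced (v ++ w) -> reduced v.
Proof. exact: prefix_sorted (prefix_prefix _ _). Qed.

(** The default value [l] of [last] differs from [flip l], so that the empty word
    needs no case of its own. *)
Definition rpush w l : word F :=
  if last l w == flip l then take (size w).-1 w else rcons w l.

Lemma rpush_nil l : rpush [::] l = [:: l].
Proof. by rewrite /rpush /= flip_neq. Qed.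

Lemma rpush_rcons w x l :
  rpush (rcons w x) l = if x == flip l then w else rcons (rcons w x) l.
Proof.
by rewrite /rpush last_rcons size_rcons /= -cats1 take_size_cat.
Qed.

Lemma reduced_rpush w l : reduced w -> reduced (rpush w l).
Proof.
case/lastP: w => [|w x]; first by rewrite rpush_nil.
rewrite rpush_rcons; case: eqVneq => [_ /reduced_rconsW //|xl rw].
by rewrite reduced_rcons2 rw; apply: contraNneq xl => ->; rewrite flipK.
Qed.

Lemma rpushK w l : reduced w -> rpush (rpush w l) (flip l) = w.
Proof.
case/lastP: w => [|w x] rw.
  by rewrite rpush_nil (rpush_rcons [::]) flipK eqxx.
rewrite (rpush_rcons w); case: eqVneq rw => [-> {x}|xl] rw; last first.
  by rewrite rpush_rcons flipK eqxx.
case/lastP: w rw => [|w y]; first by rewrite rpush_nil.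
rewrite reduced_rcons2 => /andP[_ yl]; rewrite rpush_rcons flipK ifN //.
by apply: contra_neq yl => ->.
Qed.

Lemma reduced_rpushE w l : reduced (rcons w l) -> rpush w l = rcons w l.
Proof.
case/lastP: w => [|w x]; first by rewrite rpush_nil.
rewrite reduced_rcons2 rpush_rcons => /andP[_ lx]; rewrite ifN //.
by apply: contra_neq lx => ->; rewrite flipK.
Qed.

Lemma word_eval_rpush w l : (word_eval (rpush w l) = word_eval w * letter_val l)%g.
Proof.
case/lastP: w => [|w x].
  by rewrite rpush_nil word_eval_cons word_eval_nil mulg1 mul1g.
rewrite rpush_rcons; case: eqVneq => [->|_]; last by rewrite !word_eval_rcons.
by rewrite word_eval_rcons letter_val_flip mulgVK.
Qed.

Lemma word_over_rpush B w l : B l.1 -> word_over B w -> word_over B (rpush w l).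
Proof.
move=> Bl; case/lastP: w => [_|w x Bw].
  by rewrite rpush_nil; apply: word_over_cons.
rewrite rpush_rcons; case: ifP => _; last exact: word_over_rcons.
by have [] := word_over_rconsP Bw.
Qed.

Lemma size_rpush w l : size (rpush w l) <= (size w).+1.
Proof.
case/lastP: w => [|w x]; first by rewrite rpush_nil.
by rewrite rpush_rcons; case: ifP; rewrite !size_rcons // => _; do 2 apply: leqW.
Qed.

Definition reduce w : word F := foldl rpush [::] w.

Lemma reduce_rcons w l : reduce (rcons w l) = rpush (reduce w) l.
Proof. by rewrite /reduce -cats1 foldl_cat. Qed.

Lemma reduced_reduce w : reduced (reduce w).
Proof.
by elim/last_ind: w => // w l IH; rewrite reduce_rcons reduced_rpush.
Qed.

Lemma word_eval_reduce w : word_eval (reduce w) = word_eval w.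
Proof.
elim/last_ind: w => // w l IH.
by rewrite reduce_rcons word_eval_rpush IH word_eval_rcons.
Qed.

Lemma word_over_reduce B w : word_over B w -> word_over B (reduce w).
Proof.
elim/last_ind: w => // w l IH /word_over_rconsP[Bl Bw].
by rewrite reduce_rcons; apply: word_over_rpush => //; apply: IH.
Qed.

Lemma size_reduce w : size (reduce w) <= size w.
Proof.
elim/last_ind: w => // w l IH; rewrite reduce_rcons size_rcons.
by apply: leq_trans (size_rpush _ _) _.
Qed.

Lemma reduced_reduceE w : reduced w -> reduce w = w.
Proof.
elim/last_ind: w => // w l IH rw.
by rewrite reduce_rcons IH ?(reduced_rconsW rw) // reduced_rpushE.
Qed.

Section FreeBasis.
Variables (B H : set F).
Hypothesis hB : free_basis B H.

Definition nf x : word F :=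
  xget [::] [set w | [/\ word_over B w, reduced w & word_eval w = x]].

Lemma nfP x : H x -> [/\ word_over B (nf x), reduced (nf x) & word_eval (nf x) = x].
Proof.
case: hB => _ /[apply] -[w [hw _]].
by apply: (@xgetPex _ [::] [set v | [/\ word_over B v, reduced v & word_eval v = x]]); exists w.
Qed.

Lemma nf_uniq w : word_over B w -> reduced w -> nf (word_eval w) = w.
Proof.
move=> Bw rw; have Hw := hB.1 _ Bw; have [v [_ uv]] := hB.2 _ Hw.
by rewrite -(uv w) // (uv (nf (word_eval w))) //; case: (nfP Hw) => ? ? ->.
Qed.

Lemma nf_eval w : word_over B w -> nf (word_eval w) = reduce w.
Proof.
move=> Bw; rewrite -(word_eval_reduce w) nf_uniq ?reduced_reduce //.
exact: word_over_reduce.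
Qed.

Lemma nf1 : nf 1%g = [::].
Proof. by rewrite -word_eval_nil nf_uniq. Qed.

Lemma nf_letter x l : H x -> B l.1 -> nf (x * letter_val l)%g = rpush (nf x) l.
Proof.
move=> Hx Bl; have [Bx rx {1}<-] := nfP Hx.
by rewrite -word_eval_rcons nf_eval ?reduce_rcons ?reduced_reduceE //; apply: word_over_rcons.
Qed.

Lemma eval_nf x : H x -> word_eval (nf x) = x.
Proof. by case/nfP. Qed.

(** The universal property of a free basis, in terms of actions: free reduction
    does not change the effect of a word as soon as opposite letters cancel, and
    two words with the same value have the same reduction. *)
Lemma foldl_word_eval (T : Type) (D : T -> Prop) (act : T -> F * bool -> T) :
  (forall t l, B l.1 -> D t -> D (act t l)) ->
  (forall t l, B l.1 -> D t -> act (act t l) (flip l) = t) ->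
  forall w w', word_over B w -> word_over B w' -> word_eval w = word_eval w' ->
  forall t, D t -> foldl act t w = foldl act t w'.
Proof.
move=> actD actK w w' Bw Bw' eww' t Dt.
have foldD v : word_over B v -> D (foldl act t v).
  elim/last_ind: v => // v l IH /word_over_rconsP[Bl Bv].
  by rewrite foldl_rcons; apply: actD => //; apply: IH.
have foldpush v l : B l.1 -> word_over B v ->
    foldl act t (rpush v l) = act (foldl act t v) l.
  move=> Bl; case/lastP: v => [|v x Bv]; first by rewrite rpush_nil.
  have [Bx {}Bv] := word_over_rconsP Bv.
  rewrite rpush_rcons; case: eqVneq => [->|_]; rewrite !foldl_rcons //.
  by rewrite -[X in act _ X](flipK l) actK //; apply: foldD.
have foldred v : word_over B v -> foldl act t (reduce v) = foldl act t v.
  elim/last_ind: v => // v l IH /word_over_rconsP[Bl Bv].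
  rewrite reduce_rcons foldpush ?foldl_rcons ?IH //; exact: word_over_reduce.
by rewrite -foldred // -nf_eval // eww' nf_eval // foldred.
Qed.

End FreeBasis.
End Words.

(** * Subgroups of finite index, exponent sums and word length *)

Section Subgroups.
Variable F : groupType.
Implicit Types (x y g h : F) (H : set F).

Section Closure.
Variable H : set F.
Hypothesis sH : is_subgroup H.

Lemma subgroup1 : H 1%g.
Proof. by have [/mem_set] := sH; rewrite inE => /set_mem. Qed.

Lemma subgroupV x : H x -> H x^-1%g.
Proof. by move=> /mem_set Hx; apply/set_mem/(group_closedV sH). Qed.

Lemma subgroupM x y : H x -> H y -> H (x * y)%g.
Proof. by move=> /mem_set Hx /mem_set Hy; apply/set_mem/(group_closedM sH). Qed.

Lemma subgroupX x n : H x -> H (x ^+ n)%g.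
Proof.
move=> Hx; elim: n => [|n IH]; first by rewrite expg0; exact: subgroup1.
by rewrite expgS; apply: subgroupM.
Qed.

End Closure.

(** The vertices of the Schreier graph are the cosets [H x], that is, the
    inverses of the left cosets counted by the index. *)
Lemma coset_labels H k : is_subgroup H -> has_index H k ->
  exists s : F -> 'I_k, (forall i, exists x, s x = i) /\
    (forall x y, s x = s y <-> H (x * y^-1)%g).
Proof.
move=> sH /card_set_bijP[f [ff fI fS]].
pose C x : set F := [set (x^-1 * h)%g | h in H].
have CT x : [set [set (x * h)%g | h in H] | x in [set: F]] (C x) by exists x^-1%g.
exists (fun x => Ordinal (ff _ (CT x))); split.
  move=> [i ik]; have [_ [x _ <-] fx] := fS i ik.
  exists x^-1%g; apply/val_inj => /=; rewrite -fx /C; congr f.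
  by apply/seteqP; split=> _ [h Hh <-]; exists h; rewrite // invgK.
move=> x y; split=> [[/fI xy]|Hxy].
  have : C x x^-1%g by exists 1%g; [exact: subgroup1|rewrite mulg1].
  rewrite xy ?inE // => -[h Hh hx].
  rewrite -[x]invgK -hx invgM invgK mulgK; exact: subgroupV.
apply/val_inj => /=; congr f; apply/seteqP; split=> _ [h Hh <-].
  exists (y * x^-1 * h)%g; last by rewrite !mulgA mulVg mul1g.
  by apply: subgroupM => //; rewrite -[y]invgK -invgM; apply: subgroupV.
by exists (x * y^-1 * h)%g; [exact: subgroupM|rewrite !mulgA mulVg mul1g].
Qed.

End Subgroups.

Section Exponents.
Variables (F : groupType) (A : set F).
Hypothesis hA : free_basis A [set: F].
Implicit Types (x g h : F) (w : word F).
Local Open Scope ring_scope.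

Section Extension.
Variables (V : zmodType) (phi : F -> V).

Definition letter_sum (l : F * bool) : V := if l.2 then - phi l.1 else phi l.1.

Definition word_sum w : V := \sum_(l <- w) letter_sum l.

(** The homomorphism from [F] to [V] that extends [phi] on the basis [A]. *)
Definition abel g : V := word_sum (nf A g).

Lemma abel_eval w : word_over A w -> abel (word_eval w) = word_sum w.
Proof.
move=> Aw; have [An _ en] := nfP hA (I : [set: F] (word_eval w)).
pose act (t : V) l : V := t + letter_sum l.
have fold v t : foldl act t v = t + word_sum v.
  elim: v t => [|l v IH] t /=; first by rewrite /word_sum big_nil addr0.
  by rewrite IH /word_sum big_cons addrA.
have actK t l : act (act t l) (flip l) = t.
  by case: l => y []; rewrite /act /letter_sum /= ?addrK ?subrK.
have := foldl_word_eval hA (D := fun _ => True) (act := act)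
  (fun _ _ _ => id) (fun t l _ _ => actK t l) An Aw en (t := 0) I.
by rewrite !fold !add0r.
Qed.

Lemma abelM g h : abel (g * h)%g = abel g + abel h.
Proof.
have [Ag _ eg] := nfP hA (I : [set: F] g); have [Ah _ eh] := nfP hA (I : [set: F] h).
rewrite -{1}eg -{1}eh -word_eval_cat abel_eval; last exact: word_over_cat.
by rewrite /word_sum big_cat.
Qed.

Lemma abel1 : abel 1%g = 0.
Proof. by rewrite -word_eval_nil abel_eval // /word_sum big_nil. Qed.

Lemma abelV g : abel g^-1%g = - abel g.
Proof. by apply/eqP; rewrite -addr_eq0 -abelM mulVg abel1. Qed.

Lemma abelX g n : abel (g ^+ n)%g = abel g *+ n.
Proof. by elim: n => [|n IH]; rewrite ?abel1 // expgS abelM IH mulrS. Qed.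

Lemma abel_letter a : A a -> abel a = phi a.
Proof.
move=> Aa; rewrite -[a in LHS]mulg1 -[(_ * _)%g]/(letter_val (a, false) * 1)%g.
rewrite -word_eval_nil -word_eval_cons abel_eval; last exact: word_over_cons.
by rewrite /word_sum big_seq1.
Qed.

End Extension.

(** The exponent sum of the letter [x]. *)
Definition expo x : F -> int := abel (fun y => (y == x)%:R).

(** Otherwise [H] is cyclic, so the exponent sums in [a] and [b] of its elements
    are multiples of those of [g]; but [H] contains a power of [a] and a power
    of [b]. *)
Lemma basis_neq_singleton H k B g a b : is_subgroup H -> has_index H k ->
  free_basis B H -> A a -> A b -> a != b -> exists2 c, B c & c != g.
Proof.
move=> sH /(coset_labels sH)[s [_ sP]] hB Aa Ab ab; apply: contrapT => nB.
have {nB} Bg c : B c -> c = g.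
  by move=> Bc; apply/eqP/negPn/negP => cg; apply: nB; exists c.
have pow c : exists2 n, (0 < n)%N & H (c ^+ n)%g.
  have /injectivePn[i [j ij]] : ~~ injectiveb (fun i : 'I_k.+1 => s (c ^+ i)%g).
    apply/negP => /injectiveP/leq_card; by rewrite !card_ord ltnn.
  wlog lij : i j ij / (i < j)%N => [W|] sij.
    by move: (ij); rewrite -(inj_eq val_inj) neq_ltn => /orP[] /W; apply; rewrite // eq_sym.
  exists (j - i)%N; first by rewrite subn_gt0.
  by have /sP := esym sij; rewrite -{1}(subnK (ltnW lij)) expgnDr mulgK.
have cyc h : H h -> exists z : int, forall x, expo x h = z * expo x g.
  case/(hB.2) => w [[Bw _ <-] _]; elim: w Bw => [|l w IH] Bw.
    by exists 0 => x; rewrite word_eval_nil /expo abel1 mul0r.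
  have [|z zP] := IH; first by move=> l' l'w; apply: Bw; rewrite inE l'w orbT.
  exists ((if l.2 then -1 else 1) + z) => x; rewrite word_eval_cons /expo abelM -/(expo x) zP mulrDl.
  congr (_ + _); rewrite /letter_val (Bg l.1); last by apply: Bw; rewrite mem_head.
  by case: l.2; rewrite /expo ?abelV ?mulN1r ?mul1r.
have [n n0 /cyc[z zP]] := pow a; have [m m0 /cyc[t tP]] := pow b.
have := zP a; have := zP b; have := tP b; have := tP a.
rewrite /expo !abelX !(abel_letter _ Aa) !(abel_letter _ Ab) !eqxx (negPf ab) eq_sym (negPf ab) !mul0rn.
move=> /esym/eqP; rewrite mulf_eq0 => /orP[]/eqP -> .
  by rewrite mul0r => /eqP; rewrite pnatr_eq0 (gtn_eqF m0).
by rewrite mulr0 => _ _ /eqP; rewrite pnatr_eq0 (gtn_eqF n0).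
Qed.

End Exponents.

Section Length.
Variables (F : groupType) (A : set F).
Hypothesis hA : free_basis A [set: F].
Implicit Types (x y : F).

Definition len x := size (nf A x).

Lemma len_eval w : word_over A w -> len (word_eval w) <= size w.
Proof. by move=> Aw; rewrite /len (nf_eval hA) // size_reduce. Qed.

Lemma len_reduced w : word_over A w -> reduced w -> len (word_eval w) = size w.
Proof. by move=> Aw rw; rewrite /len (nf_uniq hA). Qed.

Lemma lenM x y : len (x * y)%g <= len x + len y.
Proof.
have [Ax _ ex] := nfP hA (I : [set: F] x); have [Ay _ ey] := nfP hA (I : [set: F] y).
rewrite -{1}ex -{1}ey -word_eval_cat -size_cat; apply: len_eval.
exact: word_over_cat.
Qed.

Lemma lenV x : len x^-1%g = len x.
Proof.
have le y : len y^-1%g <= len y.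
  have [Ay _ ey] := nfP hA (I : [set: F] y).
  rewrite -{1}ey -word_eval_inv; apply: leq_trans (len_eval (word_over_inv Ay)) _.
  by rewrite size_rev size_map.
by apply/eqP; rewrite eqn_leq le -{1}[x]invgK le.
Qed.

Lemma len_mulr x y : len x <= len (x * y)%g + len y.
Proof. by rewrite -{1}(mulgK y x) -(lenV y) lenM. Qed.

Lemma len1 : len 1%g = 0.
Proof. by rewrite /len (nf1 hA). Qed.

Lemma len_mull x y : len y <= len (x * y)%g + len x.
Proof. by rewrite -{1}(mulKg x y) addnC -(lenV x) lenM. Qed.

End Length.

(** * Mixing of the lazy positive walk *)

(** This is [(1 - 1 / X) ^ X <= 1 / 2], without denominators. *)
Lemma double_pred_exp X : 0 < X -> 2 * X.-1 ^ X <= X ^ X.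
Proof.
case: X => // -[|y] _; first by rewrite exp0n.
have H j : y.+1 ^ j * (y.+1 + j) <= y.+2 ^ j * y.+1.
  elim: j => [|j IH]; first by rewrite !expn0 addn0.
  rewrite !expnS; apply: leq_trans (_ : y.+2 * (y.+1 ^ j * (y.+1 + j)) <= _).
    rewrite -mulnA (mulnCA y.+1) (mulnCA y.+2) leq_mul2l; apply/orP; right; nia.
  by rewrite -!mulnA leq_mul2l IH orbT.
rewrite -(leq_pmul2r (ltn0Sn y)); apply: leq_trans (H _) => /=.
rewrite mulnAC mulnC leq_mul2l; apply/orP; right; lia.
Qed.

Section Walks.
Variables (N k : nat) (sigma : 'I_N -> 'I_k -> 'I_k).
Hypothesis sigmaI : forall a, injective (sigma a).
Implicit Types (a c : 'I_N) (x y s t : 'I_k) (u v : seq 'I_N).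

Definition walk s u : 'I_k := foldl (fun x c => sigma c x) s u.

Lemma walk_cat s u v : walk s (u ++ v) = walk (walk s u) v.
Proof. exact: foldl_cat. Qed.

Definition moves_adjacent : rel 'I_k :=
  fun x y => [exists a, (y == sigma a x) || (x == sigma a y)].

Definition moves_connected := [forall x, forall y, connect moves_adjacent x y].

(** The trajectories of length [l] of the lazy random walk, with multiplicities:
    the laziness makes the walk aperiodic although all its letters are positive. *)
Fixpoint lazy_words (l : nat) : seq (seq 'I_N) :=
  if l is l'.+1 then
    lazy_words l' ++ [seq c :: v | c <- enum 'I_N, v <- lazy_words l']
  else [:: [::]].

Lemma size_lazy_words l : size (lazy_words l) = N.+1 ^ l.
Proof.
elim: l => //= l IH; rewrite size_cat size_allpairs IH size_enum_ord expnS; lia.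
Qed.

Lemma size_lazy_word l v : v \in lazy_words l -> size v <= l.
Proof.
elim: l v => [|l IH] v /=; first by rewrite inE => /eqP->.
rewrite mem_cat => /orP[/IH/leqW //|/allpairsP[[c v'] [_ /= /IH ? ->]]] //.
Qed.

Local Open Scope ring_scope.
Variable R : rcfType.
Implicit Types f : 'I_k -> R.

(** The transition operator of the walk, times [N.+1]. *)
Definition lazy_step f : 'I_k -> R := fun x => f x + \sum_a f (sigma a x).

Lemma sum_lazy_words f l s :
  \sum_(v <- lazy_words l) f (walk s v) = iter l lazy_step f s.
Proof.
elim: l s => [|l IH] s /=; first by rewrite big_seq1.
rewrite big_cat /= IH; congr (_ + _); rewrite big_allpairs_dep big_enum /=.
by apply: eq_bigr => c _; rewrite -IH.
Qed.

Definition sqnorm f : R := \sum_x f x ^+ 2.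

Definition energy f : R := \sum_x \sum_a (f (sigma a x) - f x) ^+ 2.

Lemma sum_sigma a f : \sum_x f (sigma a x) = \sum_x f x.
Proof. by rewrite [RHS](reindex_inj (@sigmaI a)). Qed.

Lemma sum_lazy_step f : \sum_x lazy_step f x = N.+1%:R * \sum_x f x.
Proof.
rewrite big_split /= exchange_big /=.
under [X in _ + X]eq_bigr do rewrite sum_sigma.
by rewrite sumr_const card_ord -mulrS mulr_natl.
Qed.

(** The difference of the two sides is half the sum of the squares
    [(y i - y j) ^+ 2]. *)
Lemma sqr_sum_le n (y : 'I_n -> R) : (\sum_i y i) ^+ 2 <= n%:R * \sum_i y i ^+ 2.
Proof.
have : 0 <= \sum_i \sum_j (y i - y j) ^+ 2.
  by do 2 apply: sumr_ge0 => ? _; rewrite sqr_ge0.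
have -> : \sum_i \sum_j (y i - y j) ^+ 2 =
    (n%:R * \sum_i y i ^+ 2 - (\sum_i y i) ^+ 2) *+ 2.
  under eq_bigr => i _.
    under eq_bigr do rewrite sqrrB.
    rewrite !big_split /=.
    rewrite sumr_const card_ord sumrN sumrMnl -mulr_sumr.
    over.
  rewrite !big_split /= sumrN !sumrMnl -mulr_suml sumr_const card_ord.
  by move: (\sum_i y i) (\sum_i y i ^+ 2) => S Q; rewrite -[Q *+ n]mulr_natl; ring.
by rewrite pmulrn_lge0 // subr_ge0.
Qed.

(** At each vertex the loss is the variance of the values of [f] at the [N.+1]
    possible next vertices. Staying in place is one of the possibilities, so the
    variance controls the variation of [f] along the edges. *)
Lemma sqnorm_lazy_step f :
  sqnorm (lazy_step f) + energy f <= N.+1%:R ^+ 2 * sqnorm f.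
Proof.
have -> : N.+1%:R ^+ 2 * sqnorm f =
    N.+1%:R * \sum_x (f x ^+ 2 + \sum_a f (sigma a x) ^+ 2).
  rewrite big_split /= exchange_big /=.
  under [X in _ + X]eq_bigr do rewrite (sum_sigma _ (fun x => f x ^+ 2)).
  by rewrite sumr_const card_ord -mulrS -/(sqnorm f) expr2 -mulrA (mulr_natl (sqnorm f)).
rewrite -big_split mulr_sumr; apply: ler_sum => x _ /=.
have := sqr_sum_le (fun a => f (sigma a x)).
have -> : \sum_a (f (sigma a x) - f x) ^+ 2 = \sum_a f (sigma a x) ^+ 2
    - f x * (\sum_a f (sigma a x)) *+ 2 + N%:R * f x ^+ 2.
  under eq_bigr do rewrite sqrrB.
  rewrite !big_split /= sumrN sumrMnl -mulr_suml sumr_const card_ord.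
  by rewrite mulr_natl (mulrC (f x)).
rewrite /lazy_step -[N.+1%:R]natr1; set S := \sum_a _; set Q := \sum_a _.
rewrite -mulr_natl; move: (f x) S Q N%:R => z S Q n; lra.
Qed.

Lemma energy_ge f x y : moves_adjacent x y -> `|f x - f y| <= Num.sqrt (energy f).
Proof.
have le_energy z a : `|f (sigma a z) - f z| <= Num.sqrt (energy f).
  rewrite -sqrtr_sqr ler_sqrt; last first.
    by do 2 apply: sumr_ge0 => ? _; rewrite sqr_ge0.
  rewrite /energy (bigD1 z) //= (bigD1 a) //= -addrA lerDl addr_ge0 //.
    by apply: sumr_ge0 => ? _; rewrite sqr_ge0.
  by do 2 apply: sumr_ge0 => ? _; rewrite sqr_ge0.
by case/existsP=> a /orP[/eqP->|/eqP->] //; rewrite distrC.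
Qed.

Hypothesis conn : moves_connected.

Lemma dist_le_energy f x y : `|f x - f y| <= k%:R * Num.sqrt (energy f).
Proof.
have /connectP[p0 p0P ->] : connect moves_adjacent x y by move/forallP/(_ x)/forallP: conn.
case/shortenP: p0P => p pP up _ {p0 y}.
have pk : (size p <= k)%N.
  by apply: ltnW; have := max_card (mem (x :: p)); rewrite (card_uniqP up) card_ord.
apply: le_trans (_ : (size p)%:R * Num.sqrt (energy f) <= _); last first.
  by rewrite ler_wpM2r ?sqrtr_ge0 // ler_nat.
elim: p x pP {up pk} => [|z p IH] x /=; first by rewrite subrr normr0 mul0r.
case/andP=> xz /IH{}IH; rewrite -[f x](subrK (f z)) -addrA.
apply: le_trans (ler_normD _ _) _.
by rewrite -nat1r mulrDl mul1r lerD // energy_ge.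
Qed.

(** A function of mean zero is bounded by its oscillation, and the oscillation
    is controlled along a path of at most [k] edges. *)
Lemma sqnorm_le_energy f : \sum_x f x = 0 -> sqnorm f <= k%:R ^+ 3 * energy f.
Proof.
move=> f0; have E0 : 0 <= energy f.
  by do 2 apply: sumr_ge0 => ? _; rewrite sqr_ge0.
have fx x : f x ^+ 2 <= k%:R ^+ 2 * energy f.
  have k0 : 0 < k%:R :> R by rewrite ltr0n (leq_ltn_trans _ (ltn_ord x)).
  have : `|k%:R * f x| <= k%:R * (k%:R * Num.sqrt (energy f)).
    have -> : k%:R * f x = \sum_y (f x - f y).
      by rewrite sumrB f0 subr0 sumr_const card_ord mulr_natl.
    apply: le_trans (ler_norm_sum _ _ _) _.
    apply: le_trans (ler_sum _ (fun y _ => dist_le_energy f x y)) _.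
    by rewrite sumr_const card_ord [leRHS]mulr_natl.
  rewrite normrM gtr0_norm // ler_pM2l // => fx.
  rewrite -[energy f]sqr_sqrtr // -exprMn -[f x ^+ 2]real_normK ?num_real //.
  by rewrite lerXn2r ?nnegrE // mulr_ge0 ?sqrtr_ge0 ?ltW.
apply: le_trans (ler_sum _ (fun x _ => fx x)) _.
by rewrite sumr_const card_ord -[leLHS]mulr_natl mulrA -exprS.
Qed.

Definition mixing_den := (N.+1 ^ 2 * k ^ 3)%N.

Lemma sqnorm_iter f l : (0 < k)%N -> \sum_x f x = 0 ->
  sqnorm (iter l lazy_step f) <=
    N.+1%:R ^+ (2 * l) * (1 - mixing_den%:R^-1) ^+ l * sqnorm f.
Proof.
move=> k0 f0; elim: l => [|l IH]; first by rewrite !expr0 !mul1r.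
have fl0 : \sum_x iter l lazy_step f x = 0.
  by elim: l {IH} => //= l IH; rewrite sum_lazy_step IH mulr0.
set g := iter l lazy_step f in IH fl0 *.
have q0 : 0 <= 1 - mixing_den%:R^-1 :> R.
  rewrite subr_ge0 invf_le1 ?ler1n ?ltr0n muln_gt0 !expn_gt0 k0 //.
apply: le_trans (_ : N.+1%:R ^+ 2 * (1 - mixing_den%:R^-1) * sqnorm g <= _).
  have := sqnorm_lazy_step g; have := sqnorm_le_energy fl0.
  have kR : 0 < k%:R ^+ 3 :> R by rewrite exprn_gt0 ?ltr0n.
  have -> : N.+1%:R ^+ 2 * (1 - mixing_den%:R^-1) * sqnorm g =
     N.+1%:R ^+ 2 * sqnorm g - k%:R ^- 3 * sqnorm g.
    rewrite /mixing_den natrM !natrX; field.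
    by rewrite nat1r !pnatr_eq0 -lt0n k0.
  rewrite -ler_pdivrMl // /=; lra.
set q := 1 - _ in q0 IH *; set d := N.+1%:R in IH *.
have -> : d ^+ (2 * l.+1) * q ^+ l.+1 * sqnorm f =
   d ^+ 2 * q * (d ^+ (2 * l) * q ^+ l * sqnorm f).
  rewrite mulnS [d ^+ (2 + _)]exprD [q ^+ l.+1]exprS.
  by move: (d ^+ (2 * l)) (q ^+ l) => x y; ring.
by rewrite ler_wpM2l // mulr_ge0 // exprn_ge0.
Qed.

(** [mixing_den] steps halve the squared norm, and [2 * k + 2] halvings bring it
    below [1 / (2 * k) ^ 2]. *)
Definition mixing_time := (mixing_den * (2 * k + 2))%N.

(** The walk started at [s] is at [t] with a probability that differs from [1 / k]
    by at most the L2 norm of the deviation from uniformity, which is at most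
    [1 / 2k] after the mixing time. *)
Lemma count_lazy_words s t :
  (N.+1 ^ mixing_time <=
     count (fun v => walk s v == t) (lazy_words mixing_time) * (2 * k))%N.
Proof.
have k0 : (0 < k)%N by rewrite (leq_ltn_trans _ (ltn_ord s)).
have kR : 0 < k%:R :> R by rewrite ltr0n.
(* The deviation of the mass at [t] from the uniform one. *)
pose f x : R := (x == t)%:R - k%:R^-1.
have f0 : \sum_x f x = 0.
  rewrite sumrB sumr_const card_ord -[X in _ - X]mulr_natl mulfV ?gt_eqF //.
  by rewrite (bigD1 t) //= eqxx big1 ?addr0 ?subrr // => x /negPf->.
have f1 : sqnorm f <= 1.
  rewrite /sqnorm; under eq_bigr do rewrite sqrrB.
  rewrite !big_split /= sumrN sumrMnl -mulr_suml sumr_const card_ord.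
  have -> : \sum_(i < k) (i == t)%:R = 1 :> R.
    by rewrite (bigD1 t) //= eqxx big1 ?addr0 // => x /negPf->.
  have -> : \sum_(i < k) (i == t)%:R ^+ 2 = 1 :> R.
    by rewrite (bigD1 t) //= eqxx big1 ?addr0 ?expr1n // => x /negPf->; rewrite expr0n.
  rewrite -[X in _ + X]mulr_natl expr2 mulrA mulfV ?gt_eqF //.
  have : 0 < k%:R^-1 :> R by rewrite invr_gt0.
  lra.
set l := mixing_time; set c := count _ _.
have := sum_lazy_words f l s.
have -> : \sum_(v <- lazy_words l) f (walk s v) = c%:R - (N.+1 ^ l)%:R / k%:R.
  rewrite sumrB big_const_seq iter_addr_0 count_predT size_lazy_words.
  rewrite -[X in _ - X]mulr_natl; congr (_ - _).
  by rewrite /c -sum1_count natr_sum [RHS]big_mkcond; apply: eq_bigr => v _; case: eqP.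
move=> cE; have : (c%:R - (N.+1 ^ l)%:R / k%:R) ^+ 2 <= ((N.+1 ^ l)%:R / (2 * k%:R) : R) ^+ 2.
  rewrite cE; apply: le_trans (_ : sqnorm (iter l lazy_step f) <= _).
    rewrite /sqnorm [leRHS](bigD1 s) //= lerDl; apply: sumr_ge0 => ? _.
    by rewrite sqr_ge0.
  apply: le_trans (sqnorm_iter l k0 f0) _.
  have X0 : (0 < mixing_den)%N by rewrite muln_gt0 !expn_gt0 k0.
  have q0 : 0 <= 1 - mixing_den%:R^-1 :> R.
    by rewrite subr_ge0 invf_le1 ?ler1n ?ltr0n.
  apply: le_trans (_ : N.+1%:R ^+ (2 * l) * (1 - mixing_den%:R^-1) ^+ l <= _).
    by rewrite ler_piMr // mulr_ge0 ?exprn_ge0.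
  have Dsqr : (N.+1 ^ l)%:R ^+ 2 = N.+1%:R ^+ (2 * l) :> R.
    by rewrite natrX -exprM mulnC.
  rewrite expr_div_n Dsqr ler_pM2l; last first.
    by rewrite exprn_gt0 // ltr0n.
  apply: le_trans (_ : (2^-1) ^+ (2 * k + 2) <= _).
    rewrite exprM lerXn2r ?nnegrE ?exprn_ge0 //.
    rewrite -(ler_pM2l (_ : 0 < 2 * mixing_den%:R ^+ mixing_den)); last first.
      by rewrite mulr_gt0 // exprn_gt0 // ltr0n.
    rewrite -mulrA -exprMn mulrBr mulr1 mulfV ?pnatr_eq0 -?lt0n //.
    rewrite mulrAC mulfV // mul1r.
    have := double_pred_exp X0; rewrite -(ler_nat R) natrM !natrX.
    by rewrite -subn1 natrB.
  rewrite exprVn lef_pV2 ?posrE ?exprn_gt0 ?mulr_gt0 //.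
  rewrite -natrM -!natrX ler_nat expnMn.
  have : (k < 2 ^ k)%N by apply: ltn_expl.
  rewrite expnD mulnC (mulnC 2%N) expnM; nia.
have D0 : 0 <= (N.+1 ^ l)%:R / (2 * k%:R) :> R by rewrite divr_ge0 // mulr_ge0 // ltW.
move=> H.
rewrite -(ler_nat R) !natrM.
have : - ((N.+1 ^ l)%:R / (2 * k%:R)) <= c%:R - (N.+1 ^ l)%:R / k%:R :> R.
  rewrite lerNl; apply: le_trans (ler_norm _) _; rewrite normrN.
  by rewrite -(ler_pXn2r (_ : 0 < 2)%N) ?nnegrE // real_normK ?num_real.
have -> : (N.+1 ^ l)%:R / (2 * k%:R) = (N.+1 ^ l)%:R / k%:R / 2 :> R.
  by field; rewrite gt_eqF.
move=> h; have : (N.+1 ^ l)%:R / k%:R <= c%:R * 2 :> R by lra.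
by rewrite ler_pdivrMr // mulrA.
Qed.

End Walks.

(** * Universal words *)

Section Universal.
Variable N : nat.
Implicit Types (a b c : 'I_N) (u v w : seq 'I_N).

Definition traverses k (sigma : 'I_N -> 'I_k -> 'I_k) s t a b u :=
  exists u1 u2, u = u1 ++ a :: b :: u2 /\ walk sigma s u1 = t.

Lemma traverses_catl k (sigma : 'I_N -> 'I_k -> 'I_k) s t a b u v :
  traverses sigma s t a b u -> traverses sigma s t a b (u ++ v).
Proof. by case=> u1 [u2 [-> <-]]; exists u1, (u2 ++ v); rewrite -catA. Qed.

Lemma traverses_catr k (sigma : 'I_N -> 'I_k -> 'I_k) s t a b u v :
  traverses sigma (walk sigma s u) t a b v -> traverses sigma s t a b (u ++ v).
Proof. by case=> u1 [u2 [-> <-]]; exists (u ++ u1), u2; rewrite -catA walk_cat. Qed.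

Section FixedDegree.
Variables (R : rcfType) (k : nat) (a b : 'I_N).
Hypothesis k0 : 0 < k.

(** A permutation representation, a starting vertex and a vertex at which the turn
    [ab] has to be taken. *)
Let task := ({ffun 'I_N * 'I_k -> 'I_k} * 'I_k * 'I_k)%type.

Definition task_perm (x : task) : 'I_N -> 'I_k -> 'I_k := fun c i => x.1.1 (c, i).

Definition valid_task (x : task) :=
  [forall c, injectiveb (task_perm x c)] && moves_connected (task_perm x).

Definition undone u := [set x : task | valid_task x &
  ~~ `[< traverses (task_perm x) x.1.2 x.2 a b u >]].

Definition log_tasks := (k * (k * N + 2)).+1.

Lemma card_tasks : #|{: task}| < 2 ^ log_tasks.
Proof.
rewrite !card_prod card_ffun card_prod !card_ord -!expnSr.
apply: leq_ltn_trans (_ : 2 ^ (k * (k * N + 2)) < _); last by rewrite ltn_exp2l.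
by rewrite (expnM 2) addn2 (mulnC N) leq_exp2r // ltnW // ltn_expl.
Qed.

(** By [count_lazy_words] each task left open by [u] is settled by a proportion
    [1 / 2k] of the trajectories of the lazy walk; exchanging the two sums, some
    trajectory settles that proportion of the open tasks. *)
Lemma exists_good_segment u : exists2 v, size v <= mixing_time N k &
  #|undone (u ++ v ++ [:: a; b])| * (2 * k) <= #|undone u| * (2 * k).-1.
Proof.
set l := mixing_time N k.
pose hit v := [set x in undone u |
  walk (task_perm x) (walk (task_perm x) x.1.2 u) v == x.2].
have [v vl hv] : exists2 v, v \in lazy_words N l & #|undone u| <= #|hit v| * (2 * k).
  apply: contrapT => H.
  have lt_hit v : v \in lazy_words N l -> #|hit v| * (2 * k) < #|undone u|.
    by move=> vl; rewrite ltnNge; apply/negP => h; apply: H; exists v.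
  have : \sum_(v <- lazy_words N l) #|hit v| * (2 * k) <
         \sum_(v <- lazy_words N l) #|undone u|.
    have : lazy_words N l != [::].
      by rewrite -size_eq0 size_lazy_words expn_eq0.
    elim: (lazy_words N l) lt_hit => // v [|v' s] IH lt_hit _.
      by rewrite !big_seq1 lt_hit ?mem_head.
    rewrite big_cons [ltnRHS]big_cons -addSn leq_add ?lt_hit ?mem_head //.
    by apply/ltnW/IH => // x xs; apply: lt_hit; rewrite inE xs orbT.
  rewrite ltnNge big_const_seq count_predT iter_addn_0 size_lazy_words.
  rewrite -big_distrl /=.
  have -> : \sum_(v <- lazy_words N l) #|hit v| = \sum_(x in undone u)
     count (fun v => walk (task_perm x) (walk (task_perm x) x.1.2 u) v == x.2)
       (lazy_words N l).
    under eq_bigr => v _ do rewrite -sum1_card big_mkcond.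
    rewrite exchange_big [RHS]big_mkcond /=; apply: eq_bigr => x _.
    rewrite -sum1_count [in RHS]big_mkcond.
    case: ifP => xu; last by rewrite big1 // => v _; rewrite inE xu.
    by apply: eq_bigr => v _; rewrite inE xu.
  rewrite big_distrl /= -sum_nat_const.
  apply/negP; rewrite negbK; apply: leq_sum => x; rewrite inE => /andP[/andP[xI xC] _].
  apply: (count_lazy_words _ R) => // c; exact/injectiveP/(forallP xI).
exists v; first exact: size_lazy_word vl.
have : #|undone (u ++ v ++ [:: a; b])| + #|hit v| <= #|undone u|.
  rewrite -cardsUI (_ : _ :&: _ = finset.set0) ?cards0 ?addn0; last first.
    apply/setP => x; rewrite !inE; apply/negP => /andP[/andP[_ /asboolP nt]].
    case/andP => _ /eqP xv; apply: nt; exists (u ++ v), [::].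
    by rewrite -catA walk_cat xv.
  apply/subset_leq_card/fintype.subsetP => x; rewrite !inE => /orP[|/andP[]//].
  case/andP=> -> /asboolP nt; apply/asboolP => tr; apply: nt; exact: traverses_catl.
move: hv; move: #|_| #|_| #|_| => p q r; rewrite -subn1; nia.
Qed.

Lemma exists_segments j : exists2 u, size u <= j * (mixing_time N k + 2) &
  #|undone u| * (2 * k) ^ j <= #|{: task}| * (2 * k).-1 ^ j.
Proof.
elim: j => [|j [u szu IH]]; first by exists [::]; rewrite // !muln1 max_card.
have [v szv Hv] := exists_good_segment u.
exists (u ++ v ++ [:: a; b]); first by rewrite !size_cat /=; lia.
rewrite !expnS mulnA; apply: leq_trans (leq_mul Hv (leqnn _)) _.
by rewrite mulnAC [leqRHS]mulnCA mulnC leq_mul2l IH orbT.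
Qed.

(** After [2 * k * log_tasks] segments, the number of open tasks has been divided
    by more than the total number of tasks. *)
Lemma universal_fixed_degree : exists2 u,
  size u <= 2 * k * log_tasks * (mixing_time N k + 2) &
  forall (sigma : 'I_N -> 'I_k -> 'I_k) s t,
    (forall c, injective (sigma c)) -> moves_connected sigma -> traverses sigma s t a b u.
Proof.
have [u szu Hu] := exists_segments (2 * k * log_tasks); exists u => //.
have u0 : #|undone u| = 0.
  have h : 0 < 2 * k by rewrite muln_gt0.
  have := double_pred_exp h; rewrite -(@leq_exp2r _ _ log_tasks) // expnMn -!expnM => D.
  apply/eqP; rewrite -leqn0 leqNgt; apply/negP => U1.
  have := leq_trans D (leq_trans (leq_pmull _ U1) Hu).
  rewrite leq_mul2r leqNgt card_tasks orbF expn_eq0 => /andP[/eqP k1 _].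
  by move: k1; case: (k) k0 => // k'; rewrite mulnS.
move=> sigma s t sI sC; apply: contrapT => nt.
pose x : task := ([ffun p => sigma p.1 p.2], s, t).
have xE : task_perm x = sigma by do 2 apply: funext => ?; rewrite /task_perm ffunE.
suff : x \in undone u by rewrite (cards0_eq u0) inE.
rewrite inE /valid_task xE sC andbT; apply/andP; split; last exact/asboolP.
by apply/forallP => c; apply/injectiveP.
Qed.

End FixedDegree.

Lemma log_tasksS k m : k <= m -> log_tasks k <= log_tasks m.
Proof. by move=> km; rewrite ltnS leq_mul // leq_add2r leq_mul2r km orbT. Qed.

Lemma mixing_timeS k m : k <= m -> mixing_time N k <= mixing_time N m.
Proof.
by move=> km; rewrite leq_mul ?leq_add2r ?leq_mul2l ?km ?orbT ?leq_exp2r.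
Qed.

Definition universal m (w : seq 'I_N) :=
  forall k, 0 < k <= m -> forall (sigma : 'I_N -> 'I_k -> 'I_k) s t a b,
    (forall c, injective (sigma c)) -> moves_connected sigma -> traverses sigma s t a b w.

Lemma universal_catr m w u : universal m w -> universal m (w ++ u).
Proof. by move=> univ k km sigma s t a b sI sC; apply/traverses_catl/univ. Qed.

Lemma exists_common_word (I : finType) (P : I -> seq 'I_N -> Prop) n :
  (forall i u v, P i u -> P i (v ++ u)) -> (forall i u v, P i u -> P i (u ++ v)) ->
  (forall i, exists2 u, size u <= n & P i u) ->
  exists2 u, size u <= #|I| * n & forall i, P i u.
Proof.
move=> Pl Pr PI; have /choice[U PU] : forall i, exists u, size u <= n /\ P i u.
  by move=> i; have [u] := PI i; exists u.
exists (flatten [seq U i | i <- enum I]).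
  rewrite cardE; elim: (enum I) => //= i s IH.
  by rewrite size_cat mulSn leq_add // (PU i).1.
move=> i; have : i \in enum I by rewrite mem_enum.
elim: (enum I) => //= j s IH; rewrite inE => /predU1P[->|/IH/Pl//].
by apply: Pr; exact: (PU j).2.
Qed.

(** The words obtained for each degree and each turn work from any starting
    vertex, so they can be concatenated. *)
Lemma universal_word (R : rcfType) m : exists2 w,
  size w <= m * (N * N * (2 * m * log_tasks m * (mixing_time N m + 2))) & universal m w.
Proof.
pose P (i : 'I_m) (w : seq 'I_N) := forall (sigma : 'I_N -> 'I_i.+1 -> 'I_i.+1) s t a b,
    (forall c, injective (sigma c)) -> moves_connected sigma -> traverses sigma s t a b w.
pose len := 2 * m * log_tasks m * (mixing_time N m + 2).
have PU i : exists2 w, size w <= N * N * len & P i w.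
  pose Q (ab : 'I_N * 'I_N) w := forall (sigma : 'I_N -> 'I_i.+1 -> 'I_i.+1) s t,
    (forall c, injective (sigma c)) -> moves_connected sigma ->
    traverses sigma s t ab.1 ab.2 w.
  have QU ab : exists2 w, size w <= len & Q ab w.
    have [w szw Qw] := universal_fixed_degree R ab.1 ab.2 (ltn0Sn i).
    exists w => //; apply: leq_trans szw _; have im := ltn_ord i.
    by rewrite leq_mul ?leq_add2r ?mixing_timeS // leq_mul ?log_tasksS // leq_mul2l im orbT.
  have [||w szw Qw] := exists_common_word _ _ QU.
  - by move=> ab u v Qu sigma s t sI sC; apply/traverses_catr/Qu.
  - by move=> ab u v Qu sigma s t sI sC; apply/traverses_catl/Qu.
  exists w; first by rewrite card_prod card_ord in szw.
  by move=> sigma s t a b sI sC; exact: (Qw (a, b)).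
have [||w szw Pw] := exists_common_word _ _ PU.
- by move=> i u v Pu sigma s t a b sI sC; apply/traverses_catr/Pu.
- by move=> i u v Pu sigma s t a b sI sC; apply/traverses_catl/Pu.
exists w; first by rewrite card_ord in szw.
case=> // k /= km; exact: (Pw (Ordinal km)).
Qed.

Lemma universal_word_size m : 2 <= N -> N < m ->
  m * (N * N * (2 * m * log_tasks m * (mixing_time N m + 2))) <= m ^ 17.
Proof.
move=> N2 Nm; have m3 : 2 < m by apply: leq_trans Nm.
have h1 : log_tasks m <= m ^ 4.
  rewrite /log_tasks (_ : m ^ 4 = m * (m * m * m)); last by rewrite !expnS expn0 !mulnA muln1.
  have h : m * N + 2 <= m * m by nia.
  have h' : m * (m * N + 2) <= m * (m * m) by rewrite leq_mul2l h orbT.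
  apply: leq_ltn_trans h' _; have m0 : 0 < m by apply: ltn_trans m3.
  by rewrite ltn_pmul2l // ltn_Pmulr ?muln_gt0 ?m0 // ltnW.
have h2 : mixing_time N m + 2 <= m ^ 8.
  have hd : N.+1 ^ 2 * m ^ 3 <= m ^ 5 by rewrite (expnD m 2 3) leq_mul2r leq_exp2r // Nm orbT.
  have ht : 2 * m + 2 <= m ^ 2 by rewrite expnS expn1; nia.
  rewrite /mixing_time /mixing_den.
  apply: leq_trans (_ : m ^ 5 * m ^ 2 + 2 <= _); first by rewrite leq_add2r leq_mul.
  rewrite -expnD (expnS m 7).
  have : 0 < m ^ 7 by rewrite expn_gt0 (ltn_trans _ m3).
  by move: (m ^ 7) => x; nia.
rewrite (_ : 17 = 1 + (2 + (2 + 4 + 8)))%N // !expnD expn1 leq_mul2l; apply/orP; right.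
apply: leq_mul; first by rewrite mulnn leq_exp2r // ltnW.
apply: leq_mul h2; apply: leq_mul h1; rewrite expnS expn1 leq_mul2r; apply/orP; right; lia.
Qed.

End Universal.

(** * Positive words taking all the turns are not primitive *)

Section Monotone.
Variables (F : groupType) (N : nat) (alpha : 'I_N -> F).
Implicit Types (u v w : seq 'I_N).

Definition mono (e : bool) u : word F := [seq (alpha c, e) | c <- u].

Definition pos_eval u : F := word_eval (mono false u).

Lemma mono_over A e u : (forall c, A (alpha c)) -> word_over A (mono e u).
Proof. by move=> Aa l /mapP[c _ ->] /=; apply: Aa. Qed.

Lemma reduced_mono_cat (x : word F) e c u :
  reduced (rcons x (alpha c, e)) -> reduced (rcons x (alpha c, e) ++ mono e u).
Proof.
move=> rx; elim/last_ind: u => [|u d IH]; first by rewrite cats0.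
rewrite /mono map_rcons -rcons_cat /= -/(mono e u).
case/lastP: u IH => [|u d'] /= IH.
  by rewrite cats0 reduced_rcons2 rx /flip /= xpair_eqE negb_and /=; case: e {rx IH}; rewrite orbT.
move: IH; rewrite /mono map_rcons -rcons_cat reduced_rcons2 => -> /=.
by rewrite /flip /= xpair_eqE negb_and /=; case: e {rx}; rewrite orbT.
Qed.

Lemma reduced_mono e u : reduced (mono e u).
Proof. by case: u => // c u; apply: (@reduced_mono_cat [::]). Qed.

Lemma pos_eval_cat u v : pos_eval (u ++ v) = (pos_eval u * pos_eval v)%g.
Proof. by rewrite /pos_eval /mono map_cat word_eval_cat. Qed.

Lemma pos_eval_rcons u c : pos_eval (rcons u c) = (pos_eval u * alpha c)%g.
Proof. by rewrite /pos_eval /mono map_rcons word_eval_rcons. Qed.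

Lemma pos_eval_nil : pos_eval [::] = 1%g.
Proof. by rewrite /pos_eval word_eval_nil. Qed.

Definition repeat_word n w := flatten (nseq n w).

Lemma pos_eval_repeat n w : pos_eval (repeat_word n w) = (pos_eval w ^+ n)%g.
Proof.
elim: n => [|n IH]; first by rewrite pos_eval_nil expg0.
by rewrite /repeat_word /= pos_eval_cat IH expgS.
Qed.

Lemma size_repeat n w : size (repeat_word n w) = n * size w.
Proof. by elim: n => //= n IH; rewrite size_cat IH mulSn. Qed.

Lemma neg_eval u : word_eval (mono true (rev u)) = (pos_eval u)^-1%g.
Proof.
rewrite /pos_eval -word_eval_inv /inv_word /mono -!map_comp -map_rev.
by congr word_eval; rewrite -map_rev.
Qed.

End Monotone.

Section Whitehead.
Variables (F : groupType) (A : set F) (N : nat) (alpha : 'I_N -> F).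
Hypothesis hA : free_basis A [set: F].
Hypothesis Aalpha : forall c, A (alpha c).
Hypothesis alphaA : forall x, A x -> exists c, x = alpha c.
Hypothesis alphaI : injective alpha.
Hypothesis N2 : 2 <= N.

Variables (H B : set F) (k : nat) (w : seq 'I_N) (b : F).
Hypothesis sH : is_subgroup H.
Hypothesis iH : has_index H k.
Hypothesis hB : free_basis B H.
Let g := pos_eval alpha w.
Hypotheses (Bg : B g) (Bb : B b) (bg : b != g).
Hypothesis turns : forall f a c, exists w1 w2 h,
  [/\ H h, w = w1 ++ a :: c :: w2 & f = (h * pos_eval alpha (rcons w1 a))%g].

Notation len := (len A).

(** One side of the edge [b] at the identity in the Cayley tree of [H] for [B]. *)
Definition side h := ohead (nf B h) == Some (b, false).

Lemma subgroup_basis x : B x -> H x.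
Proof.
move=> Bx; have : H (word_eval [:: (x, false)]) by apply: hB.1; apply: word_over_cons.
by rewrite word_eval_cons word_eval_nil mulg1.
Qed.

(** Right multiplication by a letter leaves the first letter of a reduced word
    alone, except across the edge [b] at the identity. *)
Lemma side_letter h l : H h -> B l.1 -> l.1 != b \/ (h != 1%g /\ h != b) ->
  side (h * letter_val l)%g = side h.
Proof.
move=> Hh Bl cnd; rewrite /side (nf_letter hB) //.
have eh := eval_nf hB Hh.
case/lastP: (nf B h) eh => [|v x] eh.
  rewrite rpush_nil /=; apply/eqP => -[lb]; case: cnd.
    by rewrite lb eqxx.
  by case=> /eqP[]; rewrite -eh word_eval_nil.
rewrite rpush_rcons; case: v eh => [|y v] eh; last by case: ifP.
case: (eqVneq x (flip l)) => [xl|//] /=; apply/idP/idP => [/eqP//|/eqP E]; exfalso.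
have {E} xb : x = (b, false) by case: E.
have {}eh : h = b by rewrite -eh xb word_eval_cons word_eval_nil mulg1.
case: cnd => [/eqP[]|[_ /eqP]//].
by have : (flip l).1 = b by rewrite -xl xb.
Qed.

Lemma side_pow h n : H h -> side (h * g ^+ n)%g = side h.
Proof.
move=> Hh; elim: n => [|n IH]; first by rewrite expg0 mulg1.
rewrite expgSr mulgA -[g in LHS]/(letter_val (g, false)) side_letter //.
  by apply: subgroupM => //; apply: subgroupX => //; apply: subgroup_basis.
by left; rewrite eq_sym.
Qed.

Lemma side_far c : H c -> exists r, forall h, H h -> r <= len h ->
  side (h * c)%g = side h.
Proof.
case/(hB.2) => u [[Bu _ <-] _]; elim/last_ind: u Bu => [|u l IH] Bu.
  by exists 0 => h _ _; rewrite word_eval_nil mulg1.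
have [Bl {}Bu] := word_over_rconsP Bu; have [r rP] := IH Bu.
exists (maxn r (len b + len (word_eval u)).+1) => h Hh.
rewrite geq_max => /andP[rh bh]; rewrite word_eval_rcons mulgA side_letter ?rP //.
  by apply: subgroupM => //; apply: hB.1.
right; split; apply/eqP => hu.
  by have := len_mulr hA h (word_eval u); rewrite hu (len1 hA); lia.
by have := len_mulr hA h (word_eval u); rewrite hu; lia.
Qed.

(** [side] extends to all of [F] through representatives [t] of the finitely many
    cosets of [H]: an edge of the Cayley tree of [F] from [h * t] leads to
    [h * c * t'], where [c] belongs to a finite subset of [H], so [side_far] still
    applies. *)
Lemma extended_side : exists (chi : F -> bool) (r : nat),
  (forall h, H h -> chi h = side h) /\
  (forall f l, A l.1 -> r <= len f -> chi (f * letter_val l)%g = chi f).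
Proof.
have [s [sS sP]] := coset_labels sH iH.
have /choice[t0 t0P] := sS.
pose t i := if i == s 1%g then 1%g else t0 i.
have tP i : s (t i) = i by rewrite /t; case: eqP.
have Ht f : H (f * (t (s f))^-1)%g by apply/sP; rewrite tP.
pose chi f := side (f * (t (s f))^-1)%g.
have far (p : 'I_k * ('I_N * bool)) : exists r, forall f, s f = p.1 -> r <= len f ->
    chi (f * letter_val (alpha p.2.1, p.2.2))%g = chi f.
  case: p => i [c e] /=; set x := letter_val _.
  have Hc : H (t i * x * (t (s (t i * x)))^-1)%g by exact: Ht.
  have [r rP] := side_far Hc; exists (r + len (t i)) => f fi rf.
  have Hf := Ht f; rewrite fi in Hf.
  have sfx : s (f * x)%g = s (t i * x)%g.
    by apply/sP; rewrite invgM mulgA mulgK.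
  rewrite /chi sfx fi -[RHS]rP //; first by rewrite !mulgA mulgVK.
  by have := len_mulr hA f (t i)^-1%g; rewrite (lenV hA); lia.
have /choice[r rP] := far.
exists chi, (\max_p r p); split=> [h Hh|f [x e] /= /alphaA[c ->] rf].
  have -> : chi h = side (h * (t (s 1%g))^-1)%g.
    by rewrite /chi; do 4 congr (_ _); apply/sP; rewrite invg1 mulg1.
  by rewrite /t eqxx invg1 mulg1.
apply: (rP (s f, (c, e))) => //; apply: leq_trans rf.
exact: (leq_bigmax (s f, (c, e))).
Qed.

Section Cones.
Variables (chi : F -> bool) (r : nat).
Hypothesis chiH : forall h, H h -> chi h = side h.
Hypothesis chi_far : forall f l, A l.1 -> r <= len f ->
  chi (f * letter_val l)%g = chi f.

(** The points of the cone of [v] in the Cayley tree of [F] that lie outside the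
    ball of radius [r]. *)
Definition far_ext (v u : word F) :=
  [/\ word_over A (v ++ u), reduced (v ++ u) & r <= size (v ++ u)].

Definition cone_eq (v v' : word F) := forall u u', far_ext v u -> far_ext v' u' ->
  chi (word_eval (v ++ u)) = chi (word_eval (v' ++ u')).

Lemma far_cone_const v : r <= size v -> cone_eq v v.
Proof.
move=> rv; suff const u : far_ext v u -> chi (word_eval (v ++ u)) = chi (word_eval v).
  by move=> u u' /const -> /const ->.
elim/last_ind: u => [|u l IH]; first by rewrite cats0.
case; rewrite -rcons_cat => /word_over_rconsP[Al Au] /reduced_rconsW ru _.
rewrite word_eval_rcons chi_far //; last first.
  by rewrite (len_reduced hA) // size_cat (leq_trans rv) // leq_addr.
by apply: IH; split=> //; rewrite size_cat; lia.
Qed.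

(** Some translate by [h] in [H] of the axis of [g] takes the turn [ac] at [v].
    One of its ends is in each cone, and both rays go through the points
    [h * g ^ i], which lie on the same side. *)
Lemma axis_link v a c : word_over A v ->
  reduced (rcons v (alpha a, true)) -> reduced (rcons v (alpha c, false)) ->
  exists u u', [/\ far_ext (rcons v (alpha a, true)) u,
    far_ext (rcons v (alpha c, false)) u' &
    chi (word_eval (rcons v (alpha a, true) ++ u)) =
    chi (word_eval (rcons v (alpha c, false) ++ u'))].
Proof.
move=> Av ra rc; have [w1 [w2 [h [Hh wE vE]]]] := turns (word_eval v) a c.
have w0 : 0 < size w by rewrite wE size_cat /=; lia.
have Hg : H g := subgroup_basis Bg.
(* The power [r] takes the two rays out of the ball of radius [r]. *)
pose m1 := rev w1 ++ rev (repeat_word r w); pose m2 := w2 ++ repeat_word r w.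
exists (mono alpha true m1), (mono alpha false m2).
have szr : r <= size (repeat_word r w) by rewrite size_repeat leq_pmulr.
split.
- split; [|exact: reduced_mono_cat|].
    by apply: word_over_cat; [apply: word_over_rcons; first exact: Aalpha|exact: mono_over].
  by rewrite size_cat size_map /m1 size_cat !size_rev; lia.
- split; [|exact: reduced_mono_cat|].
    by apply: word_over_cat; [apply: word_over_rcons; first exact: Aalpha|exact: mono_over].
  by rewrite size_cat size_map /m2 size_cat; lia.
have -> : word_eval (rcons v (alpha a, true) ++ mono alpha true m1) =
    (h * (g ^+ r)^-1)%g.
  rewrite cat_rcons word_eval_cat -[_ :: _]/(mono alpha true (a :: m1)).
  have -> : a :: m1 = rev (repeat_word r w ++ rcons w1 a).
    by rewrite rev_cat rev_rcons.
  by rewrite neg_eval pos_eval_cat invgM mulgA vE mulgK pos_eval_repeat.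
have -> : word_eval (rcons v (alpha c, false) ++ mono alpha false m2) =
    (h * g ^+ r.+1)%g.
  rewrite cat_rcons word_eval_cat -[_ :: _]/(mono alpha false (c :: m2)).
  rewrite -/(pos_eval alpha _) vE -mulgA -pos_eval_cat expgS -pos_eval_repeat.
  have -> : rcons w1 a ++ c :: m2 = w ++ repeat_word r w.
    by rewrite cat_rcons /m2; move: (repeat_word r w) => t; rewrite wE -catA.
  by rewrite pos_eval_cat.
have Hr : H (h * (g ^+ r)^-1)%g.
  by apply: subgroupM => //; apply: subgroupV => //; apply: subgroupX.
rewrite !chiH //; last by apply: subgroupM => //; apply: subgroupX.
by rewrite side_pow // -(side_pow r Hr) mulgVK.
Qed.

Lemma cone_eq_sym v v' : cone_eq v v' -> cone_eq v' v.
Proof. by move=> h u u' fu fu'; rewrite (h u' u). Qed.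

Lemma cone_eq_trans v v' v'' : (exists u, far_ext v' u) ->
  cone_eq v v' -> cone_eq v' v'' -> cone_eq v v''.
Proof. by case=> t ft h h' u u' fu fu'; rewrite (h u t) // (h' t u'). Qed.

Lemma exists_letter v e : reduced v -> exists c, reduced (rcons v (alpha c, e)).
Proof.
pose c0 : 'I_N := Ordinal (ltnW N2); pose c1 : 'I_N := Ordinal N2.
case/lastP: v => [|v x] rv; first by exists c0.
case: (eqVneq (alpha c0, e) (flip x)) => [c0x|c0x]; last first.
  by exists c0; rewrite reduced_rcons2 c0x andbT.
exists c1; rewrite reduced_rcons2 rv -c0x xpair_eqE eqxx andbT.
by apply/eqP => /alphaI/(congr1 val).
Qed.

(** By induction on the height of [v] over the sphere of radius [r]: [chi] is
    constant far out in the cone of each child of [v], and the translates of the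
    axis of [g] link each negative child to each positive one. At least one child
    of each sign remains besides the edge towards the root, so all the children
    are linked. *)
Lemma cone_const d v : word_over A v -> reduced v -> r <= size v + d -> cone_eq v v.
Proof.
elim: d v => [|d IH] v Av rv; first by rewrite addn0 => /far_cone_const.
have [/far_cone_const//|vr] := leqP r (size v) => rd.
have child x : A x.1 -> reduced (rcons v x) -> cone_eq (rcons v x) (rcons v x).
  by move=> Ax rx; apply: IH; [exact: word_over_rcons| |rewrite size_rcons addSnnS].
have link a c : reduced (rcons v (alpha a, true)) -> reduced (rcons v (alpha c, false)) ->
    [/\ cone_eq (rcons v (alpha a, true)) (rcons v (alpha c, false)),
      exists u, far_ext (rcons v (alpha a, true)) u &
      exists u, far_ext (rcons v (alpha c, false)) u].
  move=> ra rc; have [u [u' [fu fu' uu']]] := axis_link Av ra rc.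
  split; [|by exists u|by exists u'].
  move=> t t' ft ft'.
  by rewrite (child (alpha a, true) (Aalpha a) ra t u) // uu' (child (alpha c, false) (Aalpha c) rc u' t').
have siblings x y : A x.1 -> A y.1 -> reduced (rcons v x) -> reduced (rcons v y) ->
    cone_eq (rcons v x) (rcons v y).
  case: x y => [x []] [y []] /= /alphaA[a ->] /alphaA[c ->] rx ry.
  - have [z rz] := exists_letter false rv.
    have [xz _ ez] := link _ _ rx rz; have [yz _ _] := link _ _ ry rz.
    exact: cone_eq_trans ez xz (cone_eq_sym yz).
  - by have [] := link _ _ rx ry.
  - by have [/cone_eq_sym] := link _ _ ry rx.
  have [z rz] := exists_letter true rv.
  have [zx ez _] := link _ _ rz rx; have [zy _ _] := link _ _ rz ry.
  exact: cone_eq_trans ez (cone_eq_sym zx) zy.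
case=> [|x u] [|y u']; try by case=> _ _; rewrite cats0 leqNgt vr.
  by move=> _ [_ _]; rewrite cats0 leqNgt vr.
rewrite /far_ext -!cat_rcons => fu fu'.
have letter z t : far_ext (rcons v z) t -> A z.1 /\ reduced (rcons v z).
  case=> Az rz _; split; last exact: reduced_catl rz.
  by apply: Az; rewrite mem_cat mem_rcons mem_head.
have [[Ax rx] [Ay ry]] := (letter _ _ fu, letter _ _ fu').
exact: siblings fu fu'.
Qed.

End Cones.

(** The powers [g ^ n] and [b * g ^ n] are far out and on different sides of the
    edge [b]. *)
Lemma no_basis_with_all_turns : False.
Proof.
have [chi [r [chiH chi_far]]] := extended_side.
have Hg : H g := subgroup_basis Bg; have Hb : H b := subgroup_basis Bb.
have w0 : 0 < size w.
  have [w1 [w2 [h [_ -> _]]]] := turns 1%g (Ordinal N2) (Ordinal N2).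
  by rewrite size_cat /=; lia.
have far x : r <= len x -> far_ext r [::] (nf A x).
  by have [] := nfP hA (I : [set: F] x).
pose n := r + len b.
have leng : n <= len (g ^+ n)%g.
  rewrite -pos_eval_repeat (len_reduced hA) ?reduced_mono //; last exact: mono_over.
  by rewrite size_map size_repeat leq_pmulr.
have cst := @cone_const _ _ chiH chi_far r [::] (@word_over_nil _ A) isT (leqnn _).
have := cst (nf A (g ^+ n)%g) (nf A (b * g ^+ n)%g) (far _ _) (far _ _).
have -> : r <= len (g ^+ n)%g by apply: leq_trans leng; rewrite leq_addr.
have -> : r <= len (b * g ^+ n)%g.
  by have := len_mull hA b (g ^+ n)%g; rewrite /n in leng *; lia.
move=> /(_ isT isT).
rewrite /= !(eval_nf hA) //; rewrite !chiH; first last.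
- by apply: subgroupX.
- by apply: subgroupM => //; apply: subgroupX.
rewrite side_pow // -[(g ^+ n)%g]mul1g side_pow; last exact: subgroup1.
rewrite /side (nf1 hB) -[b in nf B b]mulg1.
have -> : (b * 1)%g = word_eval [:: (b, false)] by rewrite word_eval_cons word_eval_nil.
by rewrite (nf_uniq hB) //= ?eqxx //; apply: word_over_cons.
Qed.

End Whitehead.

(** * A finite-index subgroup in which a positive word is primitive *)

Section Hall.
Variables (F : groupType) (A : set F) (N : nat) (alpha : 'I_N -> F).
Hypothesis hA : free_basis A [set: F].
Hypothesis Aalpha : forall c, A (alpha c).
Variables (n : nat) (w : seq 'I_N).
Hypothesis szw : size w = n.+1.
Implicit Types (i j : 'I_n.+1) (x : F) (v : word F) (l : F * bool).

Variable c0 : 'I_N.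

Let one : 'I_n.+1 := inZp 1.

Definition degree_mod : F -> 'I_n.+1 := abel A (fun _ => one).

Definition degree_kernel : set F := [set x | degree_mod x = 0%R].

Definition prefix_elt i : F := pos_eval alpha (take i w).

Lemma mul_one k : (one *+ k)%R = inZp k.
Proof.
elim: k => [|k IH]; first by rewrite mulr0n; apply/val_inj; rewrite /= mod0n.
by rewrite mulrS IH; apply/val_inj; rewrite /= modnDm.
Qed.

Lemma degreeM x y : degree_mod (x * y)%g = (degree_mod x + degree_mod y)%R.
Proof. exact: (abelM hA). Qed.

Lemma degreeV x : degree_mod x^-1%g = (- degree_mod x)%R.
Proof. exact: (abelV hA). Qed.

Lemma degree_letter x : A x -> degree_mod x = one.
Proof. exact: (abel_letter hA). Qed.

Lemma degree_pos u : degree_mod (pos_eval alpha u) = inZp (size u).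
Proof.
rewrite -mul_one; elim/last_ind: u => [|u c IH].
  by rewrite pos_eval_nil /degree_mod (abel1 hA).
by rewrite pos_eval_rcons degreeM IH (degree_letter (Aalpha c)) size_rcons mulrSr.
Qed.

Lemma degree_prefix_elt i : degree_mod (prefix_elt i) = i.
Proof.
rewrite degree_pos size_takel; last by rewrite szw ltnW.
by rewrite valZpK.
Qed.

Lemma degree_kernel_subgroup : is_subgroup degree_kernel.
Proof.
split=> [|x y /set_mem xK /set_mem yK]; apply/mem_set; rewrite /degree_kernel /=.
  exact: (abel1 hA).
by rewrite degreeM degreeV xK yK subrr.
Qed.

(** The powers of one letter represent the cosets. *)
Lemma degree_kernel_index : has_index degree_kernel n.+1.
Proof.
pose f (i : nat) := [set (alpha c0 ^+ i * h)%g | h in degree_kernel].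
have degX (e : nat) : degree_mod (alpha c0 ^+ e)%g = inZp e.
  by rewrite /degree_mod (abelX hA) (abel_letter hA) // mul_one.
rewrite /has_index (_ : [set _ | x in _] = f @` `I_n.+1).
  apply: inj_card_eq => i j /set_mem /= im /set_mem /= jm fij.
  have : f i (alpha c0 ^+ i)%g by exists 1%g; [exact: (abel1 hA)|rewrite mulg1].
  rewrite fij => -[h hK] /(congr1 degree_mod).
  rewrite degreeM hK addr0 !degX.
  by move/(congr1 val) => /=; rewrite !modn_small.
apply/seteqP; split=> [_ [x _ <-]|_ [i _ <-]]; last by exists (alpha c0 ^+ i)%g.
exists (val (degree_mod x)); first exact: ltn_ord.
set y := (x^-1 * alpha c0 ^+ val (degree_mod x))%g.
have dy : degree_mod y = 0%R by rewrite degreeM degreeV degX valZpK addNr.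
have -> : f (val (degree_mod x)) = [set (x * y * h)%g | h in degree_kernel].
  by rewrite /f /y mulgA mulgV mul1g.
apply/seteqP; split=> _ [h hK <-].
  by exists (y * h)%g; [rewrite /degree_kernel /= degreeM dy hK addr0|rewrite mulgA].
exists (y^-1 * h)%g; first by rewrite /degree_kernel /= degreeM degreeV dy hK oppr0 addr0.
by rewrite mulgA mulgK.
Qed.

(** The generator carried by the edge labelled [x] from the vertex [i] of the
    cyclic Schreier graph; it is trivial on the spanning tree formed by the
    prefixes of [w]. *)
Definition schreier i x : F := (prefix_elt i * x * (prefix_elt (i + one)%R)^-1)%g.

Definition schreier_basis : set F :=
  [set y | exists i x, [/\ A x, y = schreier i x & y != 1%g]].

Lemma prefix_elt0 : prefix_elt 0%R = 1%g.
Proof. by rewrite /prefix_elt take0 pos_eval_nil. Qed.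

Definition schreier_push v b e : word F := if b == 1%g then v else rpush v (b, e).

(** The Reidemeister-Schreier rewriting process, as an action of the letters of [A]
    on the pairs of a vertex and a reduced word recorded on the way. *)
Definition rewriting (t : 'I_n.+1 * word F) l : 'I_n.+1 * word F :=
  if l.2 then ((t.1 - one)%R, schreier_push t.2 (schreier (t.1 - one)%R l.1) true)
  else ((t.1 + one)%R, schreier_push t.2 (schreier t.1 l.1) false).

Lemma rewriting_reduced t l : reduced t.2 -> reduced (rewriting t l).2.
Proof.
by move=> rt; rewrite /rewriting /schreier_push; case: l.2 => /=; case: ifP => // _;
  apply: reduced_rpush.
Qed.

Lemma rewritingK t l : reduced t.2 -> rewriting (rewriting t l) (flip l) = t.
Proof.
case: t l => i v [x e] rv; rewrite /rewriting; case: e => /=; rewrite ?subrK ?addrK;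
  rewrite /schreier_push; case: ifP => b1; rewrite ?b1 //; congr (_, _).
- exact: (rpushK (_, true) rv).
- exact: (rpushK (_, false) rv).
Qed.

Lemma rewriting_eval u u' t : word_over A u -> word_over A u' ->
  word_eval u = word_eval u' -> reduced t.2 -> foldl rewriting t u = foldl rewriting t u'.
Proof.
move=> Au Au' uu' rt.
apply: (foldl_word_eval hA (D := fun t => reduced t.2)) => // {t rt} t l _.
  exact: rewriting_reduced.
exact: rewritingK.
Qed.

Lemma rewriting_inv u t : word_over A u -> reduced t.2 ->
  foldl rewriting (foldl rewriting t u) (inv_word u) = t.
Proof.
move=> Au rt; rewrite -foldl_cat (@rewriting_eval _ [::]) //.
  by apply: word_over_cat => //; apply: word_over_inv.
by rewrite word_eval_cat word_eval_inv mulgV word_eval_nil.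
Qed.

Lemma word_eval_push v b e :
  word_eval (schreier_push v b e) = (word_eval v * letter_val (b, e))%g.
Proof.
rewrite /schreier_push; case: eqP => [->|_]; last exact: word_eval_rpush.
by case: e; rewrite /letter_val /= ?invg1 mulg1.
Qed.

Lemma over_push v i x e : A x -> word_over schreier_basis v ->
  word_over schreier_basis (schreier_push v (schreier i x) e).
Proof.
move=> Ax Bv; rewrite /schreier_push; case: ifPn => // b1.
by apply: word_over_rpush => //; exists i, x.
Qed.

Lemma rewriting_spec u : word_over A u ->
  let t := foldl rewriting (0%R, [::]) u in
  [/\ t.1 = degree_mod (word_eval u), word_over schreier_basis t.2, reduced t.2 &
     (word_eval t.2 * prefix_elt t.1)%g = word_eval u].
Proof.
elim/last_ind: u => [_|u l IH /word_over_rconsP[Al /IH[]]] /=.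
  by rewrite word_eval_nil /degree_mod (abel1 hA) prefix_elt0 mulg1.
rewrite foldl_rcons word_eval_rcons degreeM; case: (foldl _ _ _) => i v /= iE Bv rv vE.
case: l Al => x [] /= Ax; rewrite /rewriting /letter_val /= -iE; split.
- by rewrite degreeV degree_letter.
- exact: over_push.
- by rewrite /schreier_push; case: ifP => // _; apply: reduced_rpush.
- rewrite word_eval_push /letter_val /= /schreier subrK !invgM invgK -vE.
  by rewrite !mulgA mulgVK.
- by rewrite degree_letter.
- exact: over_push.
- by rewrite /schreier_push; case: ifP => // _; apply: reduced_rpush.
by rewrite word_eval_push /letter_val /= /schreier -vE !mulgA mulgVK.
Qed.

(** The prefixes of [w] run along the spanning tree and record nothing. *)
Lemma rewriting_prefix k v : k <= n ->
  foldl rewriting (0%R, v) (mono alpha false (take k w)) = (inZp k, v).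
Proof.
elim: k => [|k IH] kn; first by rewrite take0 /=; congr (_, _); apply/val_inj; rewrite /= mod0n.
have kw : k < size w by rewrite szw ltnW.
rewrite (take_nth c0) // /mono map_rcons foldl_rcons -/(mono _ _ _) IH; last exact: ltnW.
have k1 : (inZp k + one)%R = inZp k.+1 :> 'I_n.+1.
  by rewrite -!mul_one mulrSr.
rewrite /rewriting /= k1 /schreier_push /schreier k1 /prefix_elt /=.
rewrite !modn_small ?ltnS //; last exact: ltnW.
by rewrite (take_nth c0) // pos_eval_rcons mulgV eqxx.
Qed.

(** The value of [u] is a Schreier generator or its inverse: reading it goes out
    along the tree, through the edge that carries the generator, and back along
    the tree. *)
Lemma rewriting_letter u v l : word_over A u -> reduced v -> schreier_basis l.1 ->
  word_eval u = letter_val l -> foldl rewriting (0%R, v) u = (0%R, rpush v l).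
Proof.
have tree i v' : foldl rewriting (0%R, v') (mono alpha false (take i w)) = (i, v').
  by rewrite rewriting_prefix ?valZpK // -ltnS.
have Atree (i : 'I_n.+1) : word_over A (mono alpha false (take i w)) by apply: mono_over.
have pos b u' v' : word_over A u' -> reduced v' -> schreier_basis b ->
    word_eval u' = b -> foldl rewriting (0%R, v') u' = (0%R, rpush v' (b, false)).
  move=> Au' rv' [i [x [Ax bE b1]]] u'b.
  pose z := mono alpha false (take (i + one)%R w).
  have Az : word_over A z by apply: Atree.
  pose y := mono alpha false (take i w) ++ (x, false) :: inv_word z.
  have Ay : word_over A y.
    by apply: word_over_cat => //; apply: word_over_cons => //; apply: word_over_inv.
  rewrite (rewriting_eval Au' Ay) //; last first.
    by rewrite word_eval_cat word_eval_cons word_eval_inv u'b bE mulgA.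
  have step : rewriting (i, v') (x, false) = ((i + one)%R, rpush v' (b, false)).
    by rewrite /rewriting /schreier_push /= -bE (negPf b1).
  have zE v0 : foldl rewriting (0%R, v0) z = ((i + one)%R, v0) by apply: tree.
  rewrite foldl_cat tree /= step.
  by rewrite -zE rewriting_inv //= reduced_rpush.
move=> Au rv; case: l => b [] /= Bb ub; last exact: pos.
have Aiu := word_over_inv Au.
have := pos b (inv_word u) (rpush v (b, true)) Aiu (reduced_rpush _ rv) Bb.
rewrite word_eval_inv ub /letter_val /= invgK => /(_ erefl).
rewrite -[(b, false)]/(flip (b, true)) rpushK // => <-.
have -> : foldl rewriting (foldl rewriting (0%R, rpush v (b, true)) (inv_word u)) u =
   foldl rewriting (foldl rewriting (0%R, rpush v (b, true)) (inv_word u)) (inv_word (inv_word u)).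
  by congr foldl; rewrite /inv_word map_rev revK -map_comp map_id_in // => l _ /=; rewrite flipK.
by rewrite rewriting_inv //= reduced_rpush.
Qed.

Lemma schreier_degree_kernel b : schreier_basis b -> degree_kernel b.
Proof.
case=> i [x [Ax -> _]]; rewrite /degree_kernel /= /schreier !degreeM degreeV (degree_letter Ax).
by rewrite !degree_prefix_elt subrr.
Qed.

(** Reading an element of the subgroup yields a word in the generators with the
    same value, and reading a reduced word in the generators gives this word back,
    so it is determined by its value. *)
Lemma degree_kernel_free_basis : free_basis schreier_basis degree_kernel.
Proof.
have BK y : word_over schreier_basis y -> degree_kernel (word_eval y).
  elim: y => [|l y IH] By; first by rewrite word_eval_nil; exact: (subgroup1 degree_kernel_subgroup).
  rewrite word_eval_cons; apply: (subgroupM degree_kernel_subgroup).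
    have : degree_kernel l.1 by apply: schreier_degree_kernel; apply: By; rewrite mem_head.
    by rewrite /letter_val; case: l.2 => //; apply: (subgroupV degree_kernel_subgroup).
  by apply: IH => l' l'y; apply: By; rewrite inE l'y orbT.
have read y : word_over schreier_basis y -> reduced y ->
    foldl rewriting (0%R, [::]) (nf A (word_eval y)) = (0%R, y).
  move=> By ry; rewrite -{2}(reduced_reduceE ry).
  elim/last_ind: y By {ry} => [_|y l IH /word_over_rconsP[Bl By]].
    by rewrite word_eval_nil (nf1 hA).
  have [A1 _ e1] := nfP hA (I : [set: F] (word_eval (rcons y l))).
  have [A2 _ e2] := nfP hA (I : [set: F] (word_eval y)).
  have [A3 _ e3] := nfP hA (I : [set: F] (letter_val l)).
  rewrite (@rewriting_eval _ (nf A (word_eval y) ++ nf A (letter_val l))) //.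
  - rewrite foldl_cat IH // (@rewriting_letter _ _ l) ?reduce_rcons //.
    exact: reduced_reduce.
  - exact: word_over_cat.
  - by rewrite e1 word_eval_cat e2 e3 word_eval_rcons.
split=> // x xK; have [Ax _ ex] := nfP hA (I : [set: F] x).
have [t1 Bt rt tE] := rewriting_spec Ax.
move: t1 Bt rt tE; set y := (foldl _ _ _).2 => -> By ry yE.
rewrite ex xK prefix_elt0 mulg1 in yE.
exists y; split=> // y' [By' ry' y'E].
have := read _ By' ry'; have := read _ By ry; rewrite yE y'E => ->.
by case.
Qed.

(** [w] is the generator carried by the edge that closes the cycle. *)
Lemma degree_kernel_primitive : primitive_in degree_kernel (pos_eval alpha w).
Proof.
exists schreier_basis; first exact: degree_kernel_free_basis.
exists ord_max, (alpha (nth c0 w n)); split=> //.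
  rewrite /schreier (_ : (ord_max + one)%R = 0%R); last first.
    apply/val_inj; rewrite /= /one; case: (n) => [|m] //=.
    by rewrite (modn_small (isT : 1 < m.+2)) addn1 modnn.
  by rewrite prefix_elt0 invg1 mulg1 -pos_eval_rcons -take_nth ?szw // take_oversize ?szw.
apply/eqP => w1; have := len_reduced hA (@mono_over F N alpha A false w Aalpha) (reduced_mono alpha false w).
by rewrite -/(pos_eval alpha w) w1 (len1 hA) size_map szw.
Qed.

End Hall.

(** * The lower bound *)

Section Extrema.
Implicit Types P : set nat.

Lemma min_natP P : (exists k, P k) -> P (min_nat P) /\ forall j, P j -> min_nat P <= j.
Proof.
move=> [k Pk]; have ex : exists k, `[<P k>] by exists k; exact/asboolP.
apply: (@xgetPex _ 0 [set k | P k /\ forall j, P j -> k <= j]).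
case: (ex_minnP ex) => i /asboolP Pi iP; exists i; split=> // j Pj.
by apply: iP; exact/asboolP.
Qed.

Lemma le_max_nat P M k : (forall j, P j -> j <= M) -> P k -> k <= max_nat P.
Proof.
move=> PM Pk; have ex : exists k, `[<P k>] by exists k; exact/asboolP.
have bd j : `[<P j>] -> j <= M by move/asboolP; exact: PM.
have : P (max_nat P) /\ forall j, P j -> j <= max_nat P.
  apply: (@xgetPex _ 0 [set k | P k /\ forall j, P j -> j <= k]).
  case: (ex_maxnP ex bd) => i /asboolP Pi iP; exists i; split=> // j Pj.
  by apply: iP; exact/asboolP.
by case=> _; apply.
Qed.

End Extrema.

Lemma card_I_enum (T : Type) (A : set T) N : (A #= `I_N)%card ->
  exists alpha : 'I_N -> T,
    [/\ injective alpha, forall c, A (alpha c) & forall x, A x -> exists c, x = alpha c].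
Proof.
move=> /card_set_bijP[f [ff fI fS]].
have /choice[alpha aP] : forall c : 'I_N, exists x, A x /\ f x = c.
  by move=> c; have [x Ax fx] := fS c (ltn_ord c); exists x.
exists alpha; split=> [c d cd|c|x Ax]; last 2 first.
- exact: (aP c).1.
- exists (Ordinal (ff _ Ax)); apply: fI; rewrite ?inE //; first exact: (aP _).1.
  by rewrite (aP _).2.
by apply/val_inj => /=; rewrite -(aP c).2 cd (aP d).2.
Qed.

Section Main.
Variables (F : groupType) (A : set F) (N : nat) (alpha : 'I_N -> F).
Hypothesis hA : free_basis A [set: F].
Hypothesis Aalpha : forall c, A (alpha c).
Hypothesis alphaA : forall x, A x -> exists c, x = alpha c.
Hypothesis alphaI : injective alpha.
Hypothesis N2 : 2 <= N.

(** The labels of the cosets turn the Schreier graph of [H] into a connected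
    permutation representation of degree [k]; a basis of [H] has an element other
    than the given one. *)
Lemma universal_not_primitive m w H k : universal m w -> k <= m ->
  is_subgroup H -> has_index H k -> ~ primitive_in H (pos_eval alpha w).
Proof.
move=> univ km sH iH [B hB Bg].
have [s [sS sP]] := coset_labels sH iH.
have k0 : 0 < k by apply: leq_ltn_trans (ltn_ord (s 1%g)).
have /choice[t tP] := sS.
pose sigma c i := s (t i * alpha c)%g.
have sM x y z : s x = s y -> s (x * z)%g = s (y * z)%g.
  by move=> /sP xy; apply/sP; rewrite invgM mulgA mulgK.
have sK x y z : s (x * z)%g = s (y * z)%g -> s x = s y.
  by move/(sM _ _ z^-1%g); rewrite !mulgK.
have sigmaE c x : sigma c (s x) = s (x * alpha c)%g by apply: sM; rewrite tP.
have sI c : injective (sigma c) by move=> i j /sK; rewrite !tP.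
have wE u : walk sigma (s 1%g) u = s (pos_eval alpha u).
  elim/last_ind: u => [|u c IH]; first by rewrite pos_eval_nil.
  by rewrite /walk foldl_rcons -/(walk _ _ u) IH sigmaE pos_eval_rcons.
have adjC : connect_sym (moves_adjacent sigma).
  by apply: sym_connect_sym => i j; apply: eq_existsb => c; rewrite orbC.
have conn1 f : connect (moves_adjacent sigma) (s 1%g) (s f).
  have [Af _ <-] := nfP hA (I : [set: F] f); elim/last_ind: (nf A f) Af => [|u l IH].
    by rewrite word_eval_nil connect0.
  case/word_over_rconsP => /alphaA[c lc] /IH{}IH; apply: connect_trans IH (connect1 _).
  apply/existsP; exists c; rewrite !sigmaE word_eval_rcons /letter_val lc.
  by case: l.2; rewrite ?mulgVK eqxx ?orbT.
have sC : moves_connected sigma.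
  apply/forallP => i; apply/forallP => j; have [[x <-] [y <-]] := (sS i, sS j).
  by apply: connect_trans (conn1 y); rewrite adjC conn1.
pose c0 : 'I_N := Ordinal (ltnW N2); pose c1 : 'I_N := Ordinal N2.
have c01 : alpha c0 != alpha c1 by apply/eqP => /alphaI/(congr1 val).
have [b Bb bg] := basis_neq_singleton hA (pos_eval alpha w) sH iH hB (Aalpha c0) (Aalpha c1) c01.
apply: (no_basis_with_all_turns hA Aalpha alphaA alphaI N2 sH iH hB Bg Bb bg) => f a c.
have [u1 [u2 [wu u1P]]] : traverses sigma (s 1%g) (s (f * (alpha a)^-1)%g) a c w.
  by apply: univ => //; rewrite k0.
exists u1, u2, (f * (alpha a)^-1 * (pos_eval alpha u1)^-1)%g; split=> //.
  by apply/sP; rewrite -wE u1P.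
by rewrite pos_eval_rcons mulgA !mulgVK.
Qed.

Lemma expo_pos_eval c u : expo A (alpha c) (pos_eval alpha u) = (count_mem c u)%:R%R.
Proof.
elim/last_ind: u => [|u d IH]; first by rewrite pos_eval_nil /expo (abel1 hA).
rewrite pos_eval_rcons /expo (abelM hA) (abel_letter hA _ (Aalpha d)) -/(expo _ _ _) IH.
by rewrite -cats1 count_cat /= addn0 natrD (inj_eq alphaI).
Qed.

(** The exponent of a proper power divides all the exponent sums, in particular
    two consecutive ones. *)
Lemma not_proper_power c d u : count_mem c u = (count_mem d u).+1 ->
  ~ proper_power (pos_eval alpha u).
Proof.
move=> cd [h [j [j2 gh]]]; have := expo_pos_eval c u; have := expo_pos_eval d u.
rewrite cd gh /expo !(abelX hA) -!/(expo _ _ _) -natr1 => <- /eqP.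
rewrite addrC -subr_eq -mulrnBl => /eqP; rewrite -mulr_natr => /(congr1 absz).
by rewrite abszM natz absz_nat => /eqP; rewrite muln_eq1 => /andP[_ /eqP j1]; rewrite j1 in j2.
Qed.

Lemma word_length_pos u : word_length A (pos_eval alpha u) <= size u.
Proof.
have ex : exists k, [set size x | x in [set x | word_over A x /\
    word_eval x = pos_eval alpha u]] k.
  exists (size (mono alpha false u)), (mono alpha false u) => //; split=> //.
  exact: mono_over.
have [_] := min_natP ex; apply; exists (mono alpha false u); last by rewrite size_map.
by split=> //; apply: mono_over.
Qed.

Fixpoint word_ball r : seq F := if r is r'.+1 then
    word_ball r' ++ [seq (x * letter_val (alpha p.1, p.2))%g | x <- word_ball r', p <- enum {: 'I_N * bool}]
  else [:: 1%g].

Lemma mem_word_ball g r : word_length A g <= r -> g \in word_ball r.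
Proof.
have ex : exists k, [set size x | x in [set x | word_over A x /\ word_eval x = g]] k.
  by have [Ag _ eg] := nfP hA (I : [set: F] g); exists (size (nf A g)), (nf A g).
have [[u [Au <-] szu] _] := min_natP ex; rewrite /word_length -szu => {ex szu}.
elim/last_ind: u r Au => [|u l IH] r.
  by rewrite word_eval_nil; elim: r => [|r IH] _ _ /=; rewrite ?mem_head // mem_cat IH.
case: r => [|r]; first by rewrite size_rcons.
rewrite size_rcons ltnS => /word_over_rconsP[/alphaA[c lc] /IH{}IH] /IH ur /=.
rewrite mem_cat word_eval_rcons; apply/orP; right; apply/allpairsP.
exists (word_eval u, (c, l.2)); rewrite ur mem_enum; split=> //=.
by rewrite -lc -surjective_pairing.
Qed.

(** [f_prim A r] is a maximum because balls are finite. *)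
Lemma f_prim_ge r g : word_length A g <= r -> g <> 1%g -> ~ proper_power g ->
  d_prim g <= f_prim A r.
Proof.
move=> gr g1 gp; apply: (@le_max_nat _ (\max_(x <- word_ball r) d_prim x)); last by exists g.
move=> _ [x [xr _ _] <-]; exact: leq_bigmax_seq (mem_word_ball xr) _.
Qed.

(** The element is a universal word followed by a suffix that makes the exponent
    sums of two letters consecutive; its [d_prim] is attained, as it is primitive
    in some subgroup, and cannot be attained at an index up to [m]. *)
Lemma f_prim_lower (R : rcfType) m r : N < m -> m ^ 18 <= r -> m < f_prim A r.
Proof.
move=> Nm mr; have m3 : 2 < m by apply: leq_trans Nm.
have [w szw univ] := universal_word N R m.
pose c0 : 'I_N := Ordinal (ltnW N2); pose c1 : 'I_N := Ordinal N2.
pose u := w ++ nseq (count_mem c1 w).+1 c0 ++ nseq (count_mem c0 w) c1.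
have {}univ : universal m u by apply: universal_catr.
have szu : size u <= r.
  have le_w : count_mem c0 w + count_mem c1 w <= size w.
    rewrite -(count_predC (pred1 c0) w) leq_add2l.
    by apply: sub_count => c /= /eqP->.
  apply: leq_trans mr; have := leq_trans szw (universal_word_size N2 Nm).
  have : 0 < m ^ 17 by rewrite expn_gt0 (ltn_trans _ m3).
  have : 3 * m ^ 17 <= m * m ^ 17 by rewrite leq_mul2r m3 orbT.
  rewrite !size_cat !size_nseq (expnS m 17).
  move: (count_mem c0 w) (count_mem c1 w) (size w) (m * m ^ 17) (m ^ 17) le_w => *; lia.
have cnt : count_mem c0 u = (count_mem c1 u).+1.
  rewrite !count_cat !count_nseq /=; lia.
have [n szn] : exists n, size u = n.+1 by rewrite /u !size_cat !size_nseq; eexists; rewrite addSn addnS.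
apply: leq_trans (f_prim_ge (leq_trans (word_length_pos u) szu) _ (not_proper_power cnt)).
  have [|[H [sH iH _ pH]] _] := @min_natP [set k | exists H, [/\ is_subgroup H,
      has_index H k, H (pos_eval alpha u) & primitive_in H (pos_eval alpha u)]].
    have pK := degree_kernel_primitive hA Aalpha szn c0.
    exists n.+1, (degree_kernel A n); split=> //.
    - exact: degree_kernel_subgroup.
    - exact: degree_kernel_index.
    by case: pK => B hB /(subgroup_basis hB).
  by rewrite ltnNge; apply/negP => dm; apply: (universal_not_primitive univ dm sH iH).
move=> u1; have := expo_pos_eval c0 u.
by rewrite u1 /expo (abel1 hA) cnt => /esym/eqP; rewrite pnatr_eq0.
Qed.

End Main.

Local Open Scope ring_scope.

Theorem corollaryA2 (R : realType) (N : nat) (hN : (2 <= N)%N)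
    (F : groupType) (A : set F) (hA : free_basis A [set: F])
    (cardA : (A #= `I_N)%card) :
  exists2 C : R, 0 < C &
    (\forall n \near \oo,
       expR ((ln n%:R / (C * ln (ln n%:R))) `^ (1 / 4))
         <= (f_prim A (4 * n + 4))%:R) /\
    (Babai_conjecture R ->
     \forall n \near \oo,
       n%:R `^ (1 / (C * ln (ln n%:R))) <= (f_prim A (4 * n + 4))%:R).
Proof.
have [alpha [alphaI Aalpha alphaA]] := card_I_enum cardA.
have lower (n : nat) : (N.+1 ^ 18 <= n)%N -> n%:R `^ (18^-1) <= (f_prim A (4 * n + 4))%:R :> R.
  move=> Nn; pose m := Num.truncn (n%:R `^ (18^-1) : R).
  have y0 : 0 <= n%:R `^ (18^-1) :> R by rewrite powR_ge0.
  have y18 : (n%:R `^ (18^-1)) ^+ 18 = n%:R :> R.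
    by rewrite -powR_mulrn // -powRrM mulVf // powRr1.
  have /andP[mle mlt] := truncn_itv y0; rewrite -/m in mle mlt.
  have mn : (m ^ 18 <= n)%N.
    by rewrite -(ler_nat R) natrX -y18 lerXn2r ?nnegrE.
  have Nm : (N < m)%N.
    rewrite ltnNge; apply/negP => mN.
    have : (n%:R `^ (18^-1)) ^+ 18 < (m.+1%:R : R) ^+ 18 by rewrite ltrXn2r ?nnegrE.
    rewrite y18 -natrX ltr_nat ltnNge => /negP[]; apply: leq_trans Nn.
    by rewrite leq_exp2r // ltnS.
  apply: (le_trans (ltW mlt)); rewrite ler_nat.
  apply: (f_prim_lower hA Aalpha alphaA alphaI hN R Nm).
  by apply: leq_trans mn _; lia.
(* For [n >= expR X] both [ln n >= 18 ^ 4] and [ln (ln n) >= 1] hold. *)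
pose X : R := 18 ^+ 4 + expR 1.
have X18 : 18 ^+ 4 <= X by rewrite lerDl expR_ge0.
have Xe : expR 1 <= X by rewrite lerDr exprn_ge0.
have large : \forall n \near \oo, [/\ (N.+1 ^ 18 <= n)%N, 0 < n%:R :> R,
    18 ^+ 4 <= ln (n%:R : R) & 1 <= ln (ln (n%:R : R))].
  exists (maxn (N.+1 ^ 18) (Num.truncn (expR X)).+1) => // n /=.
  rewrite geq_max => /andP[nN nX].
  have Xn : expR X <= n%:R.
    by apply: le_trans (ltW (truncnS_gt _)) _; rewrite ler_nat.
  have n0 : 0 < n%:R :> R by apply: lt_le_trans Xn; apply: expR_gt0.
  have Xln : X <= ln n%:R by rewrite -[X]expRK ler_ln ?posrE ?expR_gt0.
  have ln0 : 0 < ln n%:R :> R.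
    by apply: lt_le_trans Xln; apply: lt_le_trans Xe; apply: expR_gt0.
  split=> //; first exact: le_trans Xln.
  by rewrite -{1}[1]expRK ler_ln ?posrE ?expR_gt0 // (le_trans Xe).
(* With [C = 18] and [x = ln n], the two bounds are at most [n `^ (1 / 18)]: the
   second because [ln x >= 1], the first because [x / (18 * ln x) <= x] and
   [x `^ (1 / 4) <= x / 18]. *)
exists 18 => //; split=> [|_]; apply: filterS large => n [nN n0 lnn lnlnn].
  apply: le_trans (lower n nN); rewrite /powR (gt_eqF n0) ler_expR -/(powR _ _).
  set x := ln n%:R in lnn lnlnn *.
  have x0 : 0 < x by apply: lt_le_trans lnn; rewrite exprn_gt0.
  apply: le_trans (_ : x `^ (1 / 4) <= _).
    have lx : 0 < 18 * ln x by rewrite mulr_gt0 // (lt_le_trans _ lnlnn).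
    apply: ge0_ler_powR; rewrite ?nnegrE ?divr_ge0 // ?(ltW x0) ?(ltW lx) //.
    rewrite ler_pdivrMr // ler_peMr ?(ltW x0) //; lra.
  set z := x `^ (1 / 4); have z0 : 0 <= z by rewrite powR_ge0.
  have z4 : z ^+ 4 = x by rewrite -powR_mulrn // -powRrM mul1r mulVf // powRr1 ?ltW.
  have z18 : 18 <= z by rewrite -(ler_pXn2r (isT : (0 < 4)%N)) ?nnegrE // z4.
  rewrite -z4 mulrC ler_pdivlMr //.
  rewrite (exprS z 3) ler_wpM2l // (le_trans z18) // ler_eXnr //.
  by rewrite (le_trans _ z18) // ler1n.
apply: le_trans (lower n nN).
apply: ler_powR; first by rewrite ler1n -(ltr0n R).
rewrite mul1r lef_pV2 ?posrE ?mulr_gt0 ?(lt_le_trans _ lnlnn) //; lra.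
Qed.
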